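(* Let $\Phi$ be an irreducible crystallographic root system in $V=\mathbb{R}^\ell$ with $\ell\ge 2$, with positive system $\Phi^+$, simple system $\Delta$, largest highest-root coefficient $c_{\max}$, and exponents $m_1\le m_2\le\cdots\le m_\ell$ of its Weyl group. Set $\mathcal{U}:=\{\theta_i\in\Phi^+ \mid \mathrm{ht}(\theta_i)>m_{\ell-1}\}$ and $m:=|\mathcal{U}|$, so $\mathcal{U}=\{\theta_1,\ldots,\theta_m\}$, and suppose that the elements are labeled so that $\xi_i:=\theta_i-\theta_{i+1}\in\Delta$ for $1\le i\le m-1$. If there is an integer $t$ such that $1\le t\le m-1$ and $\langle\theta_t,\xi_t\rangle=3$, then $c_{\max}=m_2-2$. Otherwise, $c_{\max}=m_2-1$.
   Context: $V=\mathbb{R}^\ell$ carries the standard inner product $(\cdot,\cdot)$; for $\alpha\in V$, $\beta\in V\setminus\{0\}$, $\langle\alpha,\beta\rangle:=\frac{2(\alpha,\beta)}{(\beta,\beta)}$. Root systems are reduced and span $V$. $\Phi^+$ is a fixed set of positive roots and $\Delta=\{\alpha_1,\ldots,\alpha_\ell\}$ is the corresponding simple system. For $\alpha=\sum_{i=1}^\ell d_i\alpha_i\in\Phi^+$, the height is $\mathrm{ht}(\alpha):=\sum_{i=1}^\ell d_i$. The highest root (for the order $\beta\le\alpha$ iff $\alpha-\beta\in\sum_i\mathbb{Z}_{\ge0}\alpha_i$) is $\theta=\sum_{i=1}^\ell c_i\alpha_i$, and $c_{\max}:=\max\{c_i\mid 1\le i\le\ell\}$. The exponents $m_1\le\cdots\le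 m_\ell$ of the Weyl group $W$ are the integers with $0<m_j<\mathrm{h}$ such that the eigenvalues of a Coxeter element $s_{\alpha_1}\cdots s_{\alpha_\ell}$ (of order $\mathrm{h}$, the Coxeter number) are $\exp(2\pi\sqrt{-1}\,m_j/\mathrm{h})$, $1\le j\le\ell$. *)

(* Defs.v *)
From HB Require Import structures.
From mathcomp Require Import all_boot all_order all_algebra finmap complex.
From mathcomp Require Import all_classical all_reals all_analysis.

Set Implicit Arguments.
Unset Strict Implicit.
Unset Printing Implicit Defensive.

Import Order.TTheory GRing.Theory Num.Theory.

Local Open Scope ring_scope.

Section Defs.
Variables (R : realType) (l : nat).
Local Notation V := 'rV[R]_l.

Definition inner (u v : V) : R := \sum_(i < l) u 0 i * v 0 i.

Definition pairing (a b : V) : R := 2 * inner a b / inner b b.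

Definition reflection (b v : V) : V := v - pairing v b *: b.

Record root_system (Phi : {fset V}) : Prop := RootSystem {
  root_neq0 : 0 \notin Phi;
  root_span : <<Phi>>%VS = fullv;
  root_reflection : {in Phi &, forall a b, reflection a b \in Phi};
  root_reduced : forall a (c : R),
    a \in Phi -> c *: a \in Phi -> c = 1 \/ c = -1
}.

Definition crystallographic (Phi : {fset V}) : Prop :=
  {in Phi &, forall a b, pairing a b \is a Num.int}.

Definition irreducible_roots (Phi : {fset V}) : Prop :=
  Phi != fset0 /\
  forall A B : {fset V}, Phi = (A `|` B)%fset -> [disjoint A & B]%fset ->
    {in A & B, forall a b, inner a b = 0} -> A = fset0 \/ B = fset0.

Record positive_system (Phi Phip : {fset V}) : Prop := PositiveSystem {
  pos_sub : {subset Phip <= Phi};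
  pos_half : {in Phi, forall a, (a \in Phip) = (- a \notin Phip)};
  pos_add : {in Phip &, forall a b, a + b \in Phi -> a + b \in Phip}
}.

(* [alpha] lists the simple roots alpha_1, ..., alpha_l, from index 0. *)
Record simple_system (Phip : {fset V}) (alpha : l.-tuple V) : Prop :=
  SimpleSystem {
  simple_pos : {subset alpha <= Phip};
  simple_basis : basis_of fullv alpha;
  simple_coord : {in Phip, forall b i, coord alpha i b \is a Num.nat}
}.

Definition ht (alpha : l.-tuple V) (b : V) : R := \sum_(i < l) coord alpha i b.

Definition root_le (alpha : l.-tuple V) (b a : V) : Prop :=
  forall i, coord alpha i (a - b) \is a Num.nat.

Definition highest_root (Phip : {fset V}) (alpha : l.-tuple V) (theta : V) :
    Prop :=
  theta \in Phip /\ {in Phip, forall b, root_le alpha b theta}.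

(* The default value 0 of the maximum is harmless: theta is a positive root. *)
Definition cmax (alpha : l.-tuple V) (theta : V) : R :=
  \big[Num.max/0]_(i < l) coord alpha i theta.

(* v |-> s_{alpha_1} (s_{alpha_2} (... (s_{alpha_l} v))) *)
Definition coxeter_elt (alpha : l.-tuple V) (v : V) : V :=
  foldr reflection v alpha.

Definition coxeter_number (alpha : l.-tuple V) (h : nat) : Prop :=
  [/\ (0 < h)%N,
      iter h (coxeter_elt alpha) =1 id
    & forall k, (0 < k < h)%N -> ~ (iter k (coxeter_elt alpha) =1 id)].

(* exp (sqrt(-1) * x) *)
Definition expi (x : R) : R[i] := (cos x +i* sin x)%C.

(* The exponents are m 1 <= ... <= m l; the values of [m] outside 1 .. l are
   irrelevant.  The eigenvalues are counted with multiplicity, as the roots in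
   R[i] of the characteristic polynomial. *)
Definition exponents (alpha : l.-tuple V) (m : nat -> nat) : Prop :=
  exists2 h : nat, coxeter_number alpha h &
  [/\ forall j, (1 <= j <= l)%N -> (0 < m j < h)%N,
      forall i j, (1 <= i)%N -> (i <= j)%N -> (j <= l)%N -> (m i <= m j)%N
    & map_poly (real_complex R) (char_poly (lin1_mx (coxeter_elt alpha))) =
      \prod_(1 <= j < l.+1) ('X - (expi (2 * pi * (m j)%:R / h%:R))%:P)].

Definition upper_roots (Phip : {fset V}) (alpha : l.-tuple V) (m : nat -> nat) :
    {fset V} :=
  [fset b in Phip | (m l.-1)%:R < ht alpha b]%fset.

End Defs.

(* Main.v *)
(** Off type G2 no root pairs to 3 with a simple root, so the theorem reduces to
    [m_2 = c_max + 1]; in type G2 it is a direct computation.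

    The highest root drives a classification. Its coordinates [c_i] and those
    [d_i] of its coroot satisfy the harmonic equations
    [2 c_i = <theta, alpha_i> + sum_j |<alpha_j, alpha_i>| c_j] and their dual,
    and [sum_i c_i <alpha_i, theta> = 2] with terms [<alpha_i, theta>] in {0, 1}.
    Walking through the Dynkin diagram from a node with [<alpha_i, theta> = 1],
    these equations leave few choices at each step. In the exceptional types the
    walk reads off the labels 2, 3, ..., k of a stem; a label is at least half
    of each neighbouring one, so two arms leaving the stem start with labels
    [k / 2] and [k / 2 + 1], or [(k + 1) / 2] twice, and this bounds [k].

    For the Cartan matrix split as [L + U] (unitriangular parts) the
    characteristic polynomial of the Coxeter element is [det (X L + U)]; on a
    tree this depends only on the products [a_ij a_ji] and satisfies a
    three-term recursion when a leaf is removed. The resulting polynomials are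
    products of cyclotomic factors. Their roots determine the fractions
    [m_j / h], and [h] is the order of the Coxeter element because an element
    of finite order is diagonalizable. *)

Require Import Defs.
From HB Require Import structures.
From mathcomp Require Import all_boot all_order all_algebra finmap complex.
From mathcomp Require Import all_fingroup zify ring lra.
From mathcomp Require Import all_classical all_reals all_analysis.

Set Implicit Arguments.
Unset Strict Implicit.
Unset Printing Implicit Defensive.

Import Order.TTheory GRing.Theory Num.Theory.

Local Open Scope ring_scope.

(** * Determinants of tree-like matrices *)

Section DetSeq.
Variables (A : comNzRingType) (T : finType) (M : T -> T -> A).

(** A principal minor is named by the list of its nodes, so that pruning a tree becomes dropping
    list entries. *)
Definition detseq (s : seq T) : A :=
  \det (\matrix_(i < size s, j < size s)
         M (tnth (in_tuple s) i) (tnth (in_tuple s) j)).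

Lemma detseq_nil : detseq [::] = 1.
Proof. exact: det_mx00. Qed.

Lemma tnth_in_tuple_cons x s (i : 'I_(size s)) :
  tnth (in_tuple (x :: s)) (lift ord0 i) = tnth (in_tuple s) i :> T.
Proof. by rewrite !(tnth_nth x). Qed.

Lemma detseq_isolated x s :
  {in s, forall z, M x z = 0} -> detseq (x :: s) = M x x * detseq s.
Proof.
move=> Mx0; rewrite /detseq (expand_det_row _ ord0) big_ord_recl big1 => [|i _].
  rewrite addr0 !mxE /cofactor /= expr0 mul1r; congr (_ * \det _).
  by apply/matrixP=> i j; rewrite !mxE !tnth_in_tuple_cons.
by rewrite !mxE tnth_in_tuple_cons Mx0 ?mul0r ?mem_tnth.
Qed.

(** The row of a leaf [x] has entries only at [x] and [y]. Expanding along it, and then the second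
    cofactor along the column of [x], makes the edge enter only through the product of its two
    entries. *)
Lemma detseq_leaf x y s :
    {in s, forall z, M x z = 0} -> {in s, forall z, M z x = 0} ->
  detseq (x :: y :: s) = M x x * detseq (y :: s) - M x y * M y x * detseq s.
Proof.
move=> Mx0 M0x; rewrite /detseq (expand_det_row _ ord0) !big_ord_recl.
rewrite big1 => [|i _]; last first.
  by rewrite !mxE !(tnth_nth x) /= Mx0 ?mul0r // mem_nth ?ltn_ord.
rewrite addr0; congr (_ + _).
  rewrite !mxE /cofactor /= expr0 mul1r; congr (_ * \det _).
  by apply/matrixP=> i j; rewrite !mxE !(tnth_nth x).
rewrite /cofactor (expand_det_col _ ord0) big_ord_recl big1 => [|i _]; last first.
  rewrite !mxE; set u := tnth _ _; set w := tnth _ _.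
  have -> : w = x by rewrite /w (tnth_nth x).
  suff us : u \in s by rewrite M0x ?mul0r.
  by rewrite /u !(tnth_nth x) /= mem_nth ?ltn_ord.
rewrite addr0 /cofactor /= !mxE expr1 expr0 mul1r.
set D := \det _; set D' := \det _.
have -> : D = D'.
  by congr (\det _); apply/matrixP=> i j; rewrite !mxE !(tnth_nth x).
by rewrite !(tnth_nth x) /= mulN1r mulrN mulrA.
Qed.

Lemma detseq_tuple n (t : n.-tuple T) :
  detseq t = \det (\matrix_(i, j) M (tnth t i) (tnth t j)).
Proof.
case: t => u /= su; rewrite /detseq; move/eqP: (su) => E; subst n.
congr (\det _); apply/matrixP=> i j; rewrite !mxE.
by have a := tnth (in_tuple u) i; rewrite !(tnth_nth a).
Qed.

(** Rows and columns undergo the same permutation, so the two permutation matrices cancel in the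
    determinant. *)
Lemma detseq_perm s t : perm_eq s t -> detseq s = detseq t.
Proof.
move=> pst; pose s' := Tuple (introT eqP (perm_size pst)); pose t' := in_tuple t.
rewrite -[s]/(val s') -[t]/(val t') !detseq_tuple.
have /tuple_permP [p ps] : perm_eq s' t' by [].
have {}ps i : tnth s' i = tnth t' (p i).
  have a := tnth s' i; rewrite (tnth_nth a) ps -tnth_nth tnth_mktuple //.
set N := (X in _ = \det X).
transitivity (\det (row_perm p (col_perm p N))).
  by congr (\det _); apply/matrixP=> i j; rewrite !mxE !ps.
rewrite row_permE col_permE !det_mulmx mulrCA -det_mulmx -perm_mxM.
by rewrite mulgV perm_mx1 det1 mulr1.
Qed.

End DetSeq.

Lemma detseq_enum (A : comNzRingType) n (M : 'I_n -> 'I_n -> A) :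
  detseq M (enum 'I_n) = \det (\matrix_(i, j) M i j).
Proof.
rewrite -[enum _]val_ord_tuple detseq_tuple; congr (\det _).
by apply/matrixP=> i j; rewrite !mxE !tnth_ord_tuple.
Qed.

(** * Diagrams marked by the highest root *)

Section RestSum.
Variable T : finType.
Implicit Types (f : T -> nat) (L : seq T).

(** [L] holds the nodes already visited. With [f] the terms of a harmonic equation, this is what
    unvisited nodes must still contribute. *)
Definition rest_sum f L : nat := (\sum_(k | k \notin L) f k)%N.

Lemma rest_sum_cons f L j :
  j \notin L -> rest_sum f L = (f j + rest_sum f (j :: L))%N.
Proof.
move=> jL; rewrite /rest_sum (bigD1 j) //=; congr (_ + _)%N.
by apply: eq_bigl => k; rewrite inE negb_or andbC.
Qed.

Lemma rest_sum_cons0 f L j : f j = 0%N -> rest_sum f (j :: L) = rest_sum f L.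
Proof.
move=> fj; have [jL|jL] := boolP (j \in L); last first.
  by rewrite (rest_sum_cons _ jL) fj.
by apply: eq_bigl => k; rewrite inE negb_or; case: eqP => //= ->; rewrite jL.
Qed.

Lemma rest_sum_cat0 f L1 L2 : {in L1, forall j, f j = 0%N} ->
  rest_sum f (L1 ++ L2) = rest_sum f L2.
Proof.
elim: L1 => //= j L1 IH f0; rewrite rest_sum_cons0 ?f0 ?mem_head // IH //.
by move=> k kL; rewrite f0 // inE kL orbT.
Qed.

Lemma rest_sum0 f : rest_sum f [::] = (\sum_k f k)%N.
Proof. exact: eq_bigl. Qed.

Lemma rest_sum_pick f L : (0 < rest_sum f L)%N -> exists j,
  [/\ j \notin L, (0 < f j)%N & rest_sum f L = (f j + rest_sum f (j :: L))%N].
Proof.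
rewrite lt0n /rest_sum sum_nat_eq0 negb_forall => /existsP [j].
rewrite negb_imply => /andP [jL fj]; exists j.
by rewrite lt0n fj jL -/(rest_sum f L) -rest_sum_cons.
Qed.

Lemma rest_sum_eq0 f L : rest_sum f L = 0%N -> {in predC (mem L), f =1 fun=> 0%N}.
Proof.
by move/eqP; rewrite sum_nat_eq0 => /forallP f0 j jL; apply/eqP/(implyP (f0 j)).
Qed.

End RestSum.

(* [b i j] is $|\langle\alpha_j,\alpha_i\rangle|$ off the diagonal and 0 on it,
   [c] and [d] are the coordinates of $\theta$ in the simple roots and of
   $\theta^\vee$ in the simple coroots, and [v i] is
   $\langle\alpha_i,\theta\rangle$. *)
Record marked_diagram (T : finType) (b : T -> T -> nat) (c d v : T -> nat) :
    Prop := MarkedDiagram {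
  md_card : (1 < #|T|)%N;
  md_diag : forall i, b i i = 0%N;
  md_d_gt0 : forall i, (0 < d i)%N;
  md_d_le_c : forall i, (d i <= c i)%N;
  md_v_le1 : forall i, (v i <= 1)%N;
  md_sum_v : (\sum_i c i * v i = 2)%N;
  md_c_eq : forall i, (2 * c i * d i = c i * v i + (\sum_j b i j * c j) * d i)%N;
  md_d_eq : forall i, (2 * d i = v i + \sum_j b j i * d j)%N;
  md_sym : forall i j, (b i j * d i * c j = b j i * d j * c i)%N;
  md_le3 : forall i j, (b i j * b j i <= 3)%N;
  md_connected : forall (s : seq T) i, i \in s ->
    (forall j k, j \in s -> b j k != 0%N -> k \in s) -> forall k, k \in s
}.

(** [q] is the Coxeter polynomial in [X], [n] the rank and [cm] the largest label. Types B and C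
    agree in all of these; G2 is kept apart as the exceptional case. *)
Inductive diagram_type (A : comNzRingType) (X q : A) (n cm : nat) : Prop :=
| TypeA of (1 < n)%N & q = \sum_(i < n.+1) X ^+ i & cm = 1%N
| TypeBC of (1 < n)%N & q = X ^+ n + 1 & cm = 2%N
| TypeD of (3 < n)%N & q = (X ^+ n.-1 + 1) * (X + 1) & cm = 2%N
| TypeE6 of n = 6%N & q = (X ^+ 2 + X + 1) * (X ^+ 4 - X ^+ 2 + 1) & cm = 3%N
| TypeE7 of n = 7%N & q = (X + 1) * (X ^+ 6 - X ^+ 3 + 1) & cm = 4%N
| TypeE8 of n = 8%N
    & q = X ^+ 8 + X ^+ 7 - X ^+ 5 - X ^+ 4 - X ^+ 3 + X + 1 & cm = 6%N
| TypeF4 of n = 4%N & q = X ^+ 4 - X ^+ 2 + 1 & cm = 4%N.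

(** * Classification of marked diagrams by walks *)

Section Walk.
Variables (T : finType) (b : T -> T -> nat) (c d v : T -> nat).
Hypothesis md : marked_diagram b c d v.
Variables (A : comNzRingType) (X : A) (M : T -> T -> A).
Hypothesis M_diag : forall i, M i i = X + 1.
Hypothesis M_edge : forall i j, i != j -> M i j * M j i = (b i j * b j i)%:R * X.
Hypothesis M_nonedge : forall i j, i != j -> b i j = 0%N -> M i j = 0.

Let geom n : A := \sum_(i < n) X ^+ i.

Lemma geomSr n : geom n.+1 = geom n + X ^+ n.
Proof. by rewrite /geom big_ord_recr. Qed.

Lemma geom0 : geom 0 = 0.
Proof. exact: big_ord0. Qed.

Lemma geomS n : geom n.+1 = 1 + X * geom n.
Proof.
rewrite /geom big_ord_recl expr0 mulr_sumr; congr (_ + _).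
by apply: eq_bigr => i _; rewrite -exprS.
Qed.

Lemma c_gt0 i : (0 < c i)%N.
Proof. exact: leq_trans (md_d_gt0 md i) (md_d_le_c md i). Qed.

Lemma b_eq0 i j : b i j = 0%N -> b j i = 0%N.
Proof.
move=> bij; have := md_sym md i j; rewrite bij !mul0n => /esym/eqP.
rewrite !muln_eq0; have := md_d_gt0 md j; have := c_gt0 i.
by case: (d j) => // ?; case: (c i) => // ? _ _; rewrite !orbF => /eqP.
Qed.

(** [c i = d i] means that the simple root at [i] is as long as the highest root. Symmetry becomes
    [b i j * c j = b j i * d j], so [b i j <= b j i], and a product of at most 3 forces
    [b i j = 1]. *)
Lemma long_edge i j : c i = d i -> b i j != 0%N ->
  [/\ b i j = 1%N, c j = (b j i * d j)%N & (0 < b j i <= 3)%N].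
Proof.
move=> ci bij; have bji : b j i != 0%N.
  by apply: contraNneq bij => /b_eq0 ->.
have := md_sym md i j; have := md_le3 md i j; have := md_d_le_c md j.
have := md_d_gt0 md i; have := md_d_gt0 md j; rewrite ci.
move: (b i j) (b j i) (c j) (d i) (d j) bij bji => p q cj di dj p0 q0 dj0 di0.
move=> dcj pq E; have {E} E : (p * cj = q * dj)%N.
  by apply/eqP; rewrite -(eqn_pmul2l di0); apply/eqP; move: E; nia.
have p1 : p = 1%N by nia.
by split; nia.
Qed.

Lemma c_eq0 i : v i = 0%N -> rest_sum (fun j => b i j * c j)%N [::] = (2 * c i)%N.
Proof.
move=> vi; rewrite rest_sum0; have := md_c_eq md i; rewrite vi.
have := md_d_gt0 md i; nia.
Qed.

(** The node [i] alone exhausts the sum of all [c i * v i], which is 2. *)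
Lemma v_eq0 i j : i != j -> (c i * v i = 2)%N -> v j = 0%N.
Proof.
move=> ij vi; have := md_sum_v md; rewrite (bigD1 i) //= (bigD1 j) 1?eq_sym //=.
have := c_gt0 j; nia.
Qed.

(* [x :: t] is a closed-off part of the diagram: only [x] may have neighbours
   outside. *)
Definition frontier x t :=
  uniq (x :: t) /\ forall y j, y \in t -> j \notin x :: t -> b y j = 0%N.

(** The Coxeter polynomial of a chain of [k] nodes with simple edges is [1 + X + ... + X^k]. The
    chain without its end node is recorded too, as the leaf recursion needs both. *)
Definition det_chain x t :=
  detseq M (x :: t) = geom (size t).+2 /\ detseq M t = geom (size t).+1.

Lemma rest_sum_new (f : T -> nat) x t j : j \notin x :: t -> uniq (x :: t) ->
    f j = 0%N -> {in t, forall z, f z = 0%N} ->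
  rest_sum f [::] = (f x + rest_sum f (j :: x :: t))%N.
Proof.
move=> jxt /andP [xt _] fj ft; rewrite rest_sum_cons0 // -rest_sum_cons //.
by rewrite -[t]cats0 rest_sum_cat0.
Qed.

Lemma frontier_b_new x t j : frontier x t -> j \notin x :: t ->
  {in t, forall z, b j z = 0%N}.
Proof. by move=> [_ H] jxt z zt; apply/b_eq0/H. Qed.

(** The visited part is closed off, so in the harmonic equation at a new node [j] only [x] and
    unvisited nodes occur. [rest_d] is the dual form. *)
Lemma rest_c x t j : frontier x t -> j \notin x :: t -> v j = 0%N ->
  (2 * c j = b j x * c x
     + rest_sum (fun k => b j k * c k)%N (j :: x :: t))%N.
Proof.
move=> fxt jxt vj; rewrite -(c_eq0 vj).
rewrite (rest_sum_new jxt (proj1 fxt)) ?(md_diag md) //.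
by move=> z zt; rewrite (frontier_b_new fxt).
Qed.

Lemma rest_d x t j : frontier x t -> j \notin x :: t ->
  (2 * d j = v j + b x j * d x
     + rest_sum (fun k => b k j * d k)%N (j :: x :: t))%N.
Proof.
move=> fxt jxt; rewrite -addnA.
rewrite -(@rest_sum_new (fun k => b k j * d k)%N x t j jxt (proj1 fxt)).
- by rewrite rest_sum0 (md_d_eq md).
- by rewrite (md_diag md).
by move=> z zt; rewrite b_eq0 // (frontier_b_new fxt).
Qed.

Lemma frontier_cons x t j : frontier x t -> j \notin x :: t ->
  (forall k, k \notin j :: x :: t -> b x k = 0%N) -> frontier j (x :: t).
Proof.
move=> [uxt cxt] jxt bx; split; first by rewrite /= jxt.
move=> y k; rewrite inE => /predU1P [->|yt] kn; first exact: bx.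
by apply: cxt => //; move: kn; rewrite inE negb_or => /andP[].
Qed.

Lemma detseq_extend x t j : frontier x t -> j \notin x :: t ->
  detseq M (j :: x :: t)
    = (X + 1) * detseq M (x :: t) - (b j x * b x j)%:R * X * detseq M t.
Proof.
move=> fxt jxt; have jx : j != x by apply: contraNneq jxt => ->; rewrite mem_head.
have jt z : z \in t -> j != z.
  by move=> zt; apply: contraNneq jxt => ->; rewrite inE zt orbT.
rewrite detseq_leaf ?M_diag ?M_edge // => z zt.
  by rewrite M_nonedge ?jt // (frontier_b_new fxt).
by rewrite M_nonedge 1?eq_sym ?jt // b_eq0 // (frontier_b_new fxt).
Qed.

Lemma det_chain_cons x t j : frontier x t -> j \notin x :: t ->
  b j x = 1%N -> b x j = 1%N -> det_chain x t -> det_chain j (x :: t).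
Proof.
move=> fxt jxt bjx bxj [D1 D2]; split=> //.
rewrite (detseq_extend fxt jxt) bjx bxj D1 D2 /=.
rewrite (geomSr (size t).+2) (geomSr (size t).+1) (exprS X (size t).+1); ring.
Qed.

Lemma detseq_double x t j : frontier x t -> j \notin x :: t ->
  (b j x * b x j)%N = 2%N -> det_chain x t ->
  detseq M (j :: x :: t) = X ^+ (size t).+2 + 1.
Proof.
move=> fxt jxt bb [D1 D2]; rewrite (detseq_extend fxt jxt) bb D1 D2.
have E1 := geomS (size t).+1; have E2 := geomSr (size t).+1.
rewrite mulrDl mul1r {2}E1 E2 !exprS; ring.
Qed.

Lemma closed_all s i : i \in s -> uniq s ->
    (forall j k, j \in s -> k \notin s -> b j k = 0%N) ->
  perm_eq s (enum T) /\ forall k, k \in s.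
Proof.
move=> is_ us cs; have cov : forall k, k \in s.
  apply: (md_connected md is_) => j k js; apply: contraR => ks.
  by rewrite (cs j k).
by split=> //; apply: uniq_perm => [//||k]; rewrite ?enum_uniq // mem_enum cov.
Qed.

Definition is_max cm := (exists i, c i = cm) /\ forall i, (c i <= cm)%N.

(** The outcome away from G2. The bound [c i <= 2 * d i] says that the squared length of the highest
    root is at most twice that of the simple root at [i]; it later excludes pairings equal to 3. *)
Definition ordinary := exists2 cm, is_max cm &
  (forall i, c i <= 2 * d i)%N /\
  diagram_type X (detseq M (enum T)) #|T| cm.

Lemma size_enum s : perm_eq s (enum T) -> #|T| = size s.
Proof. by move/perm_size ->; rewrite cardE. Qed.

Lemma frontier_all x t : frontier x t ->
    (forall k, k \notin x :: t -> b x k = 0%N) ->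
  perm_eq (x :: t) (enum T) /\ forall k, k \in x :: t.
Proof.
move=> [uxt cxt] bx; apply: (@closed_all _ x) => //; first exact: mem_head.
by move=> j k; rewrite inE => /predU1P [-> //|]; [exact: bx|exact: cxt].
Qed.

Lemma frontier1 x : frontier x [::].
Proof. by []. Qed.

Lemma det_chain1 x : det_chain x [::].
Proof.
split; last by rewrite detseq_nil geomS /geom big_ord0 mulr0 addr0.
rewrite detseq_isolated // detseq_nil M_diag /geom !big_ord_recl big_ord0 /=.
by rewrite expr0 expr1 addr0 mulr1 addrC.
Qed.

(* A walk along nodes with [d = 1], started at a node with [v = 1], ends at
   another such node (type A) or at a double edge (type C). *)
Lemma chain_d1 x t y c0 : frontier x t -> det_chain x t ->
    {in x :: t, forall z, d z = 1%N /\ c z = c0} ->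
    y \in x :: t -> v y = 1%N ->
    rest_sum (fun k => b k x * d k)%N (x :: t) = 1%N -> (c0 = 1 \/ c0 = 2)%N ->
  ordinary.
Proof.
have [n leTn] := ubnP (#|T| - size (x :: t)).
elim: n x t leTn => // n IH x t leTn fxt Dxt lab yxt vy rx c01.
have [j [jxt bj E]] := @rest_sum_pick _ _ (x :: t) (eq_leq (esym rx)).
have [dj1 bjx] : d j = 1%N /\ b j x = 1%N.
  by move: bj E; rewrite rx muln_gt0; nia.
move: E; rewrite rx dj1 bjx => -[/esym rx0].
have [dx cx] := lab x (mem_head _ _).
have bx k : k \notin j :: x :: t -> b x k = 0%N.
  move=> kn; apply: b_eq0; have := rest_sum_eq0 rx0 kn.
  by move/eqP; rewrite muln_eq0 => /orP[/eqP //|]; have := md_d_gt0 md k; lia.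
have fj := frontier_cons fxt jxt bx.
have := md_sym md x j; rewrite dx dj1 bjx cx !mul1n muln1 => bcj.
have rj := rest_d fxt jxt; rewrite dx dj1 !muln1 in rj.
have szT : (size (j :: x :: t) <= #|T|)%N.
  by rewrite -(card_uniqP (proj1 fj)) max_card.
have bxj0 : (0 < b x j)%N by case: (b x j) bcj c01 => // <- [].
have labj : {in j :: x :: t, forall z, d z = 1%N /\ (c z <= c0)%N}.
  move=> z; rewrite inE => /predU1P [->|/lab [-> ->]] //; split=> //; nia.
have fin : rest_sum (fun k => b k j * d k)%N (j :: x :: t) = 0%N ->
    perm_eq (j :: x :: t) (enum T) /\ forall k, k \in j :: x :: t.
  move=> r0; apply: frontier_all fj _ => k kn; apply: b_eq0.
  have /eqP := rest_sum_eq0 r0 kn.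
  by rewrite muln_eq0 => /orP[/eqP //|]; have := md_d_gt0 md k; lia.
(* The dual equation at [j] now reads [2 = v j + b x j + rest]. *)
have [bxj|bxj] : b x j = 1%N \/ b x j = 2%N by nia.
- rewrite bxj mul1n in bcj rj.
  have [vj|vj] : v j = 0%N \/ v j = 1%N by have := md_v_le1 md j; lia.
    apply: (IH j (x :: t)) c01 => //; first by move: szT leTn => /=; lia.
    + exact: det_chain_cons.
    + by move=> z; rewrite inE => /predU1P [->|/lab].
    + by rewrite inE yxt orbT.
    + by move: rj; rewrite vj; lia.
  (* Both [y] and [j] have [v = 1], so their equal labels add up to at most 2. *)
  have c0E : c0 = 1%N.
    have := md_sum_v md; rewrite (bigD1 j) //= (bigD1 y) /=; last first.
      by apply: contraNneq jxt => <-.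
    by rewrite vj vy bcj; have [_ ->] := lab y yxt; lia.
  have [|pT cov] := fin; first by move: rj; rewrite vj; lia.
  exists c0; first split.
  + by exists j.
  + by move=> i; have [_ ->] := labj i (cov i).
  split.
    by move=> i; have [-> ?] := labj i (cov i); rewrite muln1; lia.
  apply: TypeA => //; first exact: md_card md.
  rewrite -(detseq_perm _ pT) (size_enum pT).
  by have [-> _] := det_chain_cons fxt jxt bjx bxj Dxt.
(* Symmetry gives [2 * c j = c0]: the node [j] has label 1 and is the long end of type C. *)
rewrite bxj in rj bcj; have c0E : c0 = 2%N by lia.
have [|pT cov] := fin; first by lia.
exists c0; first split.
+ by exists x.
+ by move=> i; have [_ ->] := labj i (cov i).
split; first by move=> i; have [-> ?] := labj i (cov i); rewrite muln1; lia.
apply: TypeBC => //; first exact: md_card md.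
by rewrite -(detseq_perm _ pT) (size_enum pT) (detseq_double fxt jxt) ?bjx ?bxj.
Qed.


(** Here the leaf hangs on a node in the middle of the list, as happens at a branch node; a
    permutation first brings [x] next to [j]. *)
Lemma detseq_attach j u x t : j \notin u ++ x :: t ->
    {in u ++ t, forall z, b j z = 0%N} ->
  detseq M (j :: u ++ x :: t) = (X + 1) * detseq M (u ++ x :: t)
    - (b j x * b x j)%:R * X * detseq M (u ++ t).
Proof.
move=> jn bj; have pcat : perm_eq (u ++ x :: t) (x :: u ++ t).
  by rewrite -cat1s perm_catCA.
have neqj z : z \in x :: u ++ t -> j != z.
  rewrite -(perm_mem pcat); by apply: contraTneq => <-.
rewrite (detseq_perm _ pcat) (@detseq_perm _ _ _ _ (j :: x :: u ++ t)); last first.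
  by rewrite perm_cons.
rewrite detseq_leaf ?M_diag ?M_edge ?neqj ?mem_head // => z zt.
  by rewrite M_nonedge ?bj ?neqj // inE zt orbT.
by rewrite M_nonedge ?(b_eq0 (bj z zt)) // eq_sym neqj // inE zt orbT.
Qed.

Lemma detseq_disconnected j s : j \notin s -> {in s, forall z, b j z = 0%N} ->
  detseq M (j :: s) = (X + 1) * detseq M s.
Proof.
move=> jn bj; rewrite detseq_isolated ?M_diag // => z zs.
by rewrite M_nonedge ?bj //; apply: contraNneq jn => ->.
Qed.

(** A neighbour of a long node enters its harmonic equation with coefficient 1, so the walk can
    split according to how the outstanding label sum is shared. *)
Lemma long_pick x L : c x = d x ->
    (0 < rest_sum (fun k => b x k * c k)%N L)%N -> exists j,
  [/\ j \notin L, b x j = 1%N, c j = (b j x * d j)%N, (0 < b j x <= 3)%N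
    & (rest_sum (fun k => b x k * c k)%N L
        = c j + rest_sum (fun k => b x k * c k)%N (j :: L))%N].
Proof.
move=> cdx /rest_sum_pick [j [jL]]; rewrite muln_gt0 lt0n => /andP [bxj _].
have [bx1 Ec Hb] := long_edge cdx bxj; rewrite bx1 mul1n => E.
by exists j; split.
Qed.

Lemma rest_c_eq0 x L : rest_sum (fun k => b x k * c k)%N L = 0%N ->
  forall k, k \notin L -> b x k = 0%N.
Proof.
move=> r0 k kL; have /eqP := rest_sum_eq0 r0 kL.
by rewrite muln_eq0 => /orP[/eqP //|]; have := c_gt0 k; lia.
Qed.

(* A walk along long nodes of label 2, one of which carries a leaf of label 1,
   ends at a fork (type D) or at a double edge (type B). *)
Lemma chain_c2 x t : frontier x t -> det_chain x t -> c x = 2%N -> d x = 2%N ->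
    (0 < size t)%N -> {in x :: t, forall z, c z <= 2 /\ c z <= 2 * d z}%N ->
    (forall j, j \notin x :: t -> v j = 0%N) ->
    rest_sum (fun k => b x k * c k)%N (x :: t) = 2%N ->
  ordinary.
Proof.
have [n leTn] := ubnP (#|T| - size (x :: t)).
elim: n x t leTn => // n IH x t leTn fxt Dxt cx dx t0 lab v0 rx.
have [|j [jxt bxj cj bjx E]] := @long_pick x (x :: t) (etrans cx (esym dx)).
  by rewrite rx.
have vj := v0 j jxt; rewrite rx in E.
have dj0 := md_d_gt0 md j.
have rj := rest_c fxt jxt vj; rewrite cx in rj.
have szT (u : seq T) : uniq u -> (size u <= #|T|)%N.
  by move=> uu; rewrite -(card_uniqP uu) max_card.
(* The labels outstanding at [x] add up to 2: either two leaves of label 1 (the fork) or a single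
   node of label 2. *)
have [c1|c2] : c j = 1%N \/ c j = 2%N by have := c_gt0 j; lia.
- have {cj} [bjx1 dj] : b j x = 1%N /\ d j = 1%N by nia.
  have rj0 : rest_sum (fun k => b j k * c k)%N (j :: x :: t) = 0%N.
    by move: rj; rewrite c1 bjx1; lia.
  have [|k [kn bxk ck bkx E']] := @long_pick x (j :: x :: t)
    (etrans cx (esym dx)); first by lia.
  have c1k : c k = 1%N by have := c_gt0 k; lia.
  have [bkx1 dk] : b k x = 1%N /\ d k = 1%N by have := md_d_gt0 md k; nia.
  have rx0 : rest_sum (fun k => b x k * c k)%N (k :: j :: x :: t) = 0%N by lia.
  have bjk : b j k = 0%N by exact: rest_c_eq0 rj0 _ kn.
  have [kj kxt] : k != j /\ k \notin x :: t.
    by move: kn; rewrite inE negb_or => /andP [].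
  have vk := v0 k kxt.
  have rk := rest_c fxt kxt vk; rewrite cx c1k bkx1 in rk.
  have rk0 : rest_sum (fun i => b k i * c i)%N (k :: x :: t) = 0%N by lia.
  have [uxt cxt] := fxt.
  have us : uniq (k :: j :: x :: t) by rewrite cons_uniq kn /= jxt.
  have [|||pT cov] := @closed_all (k :: j :: x :: t) k.
  + exact: mem_head.
  + by [].
  + move=> y i; rewrite 3!inE => /or4P [/eqP ->|/eqP ->|/eqP ->|yt] ni.
    * by apply: rest_c_eq0 rk0 _ _; move: ni; rewrite !inE !negb_or => /and4P [-> _ -> ->].
    * by apply: rest_c_eq0 rj0 _ _; move: ni; rewrite !inE !negb_or => /and4P [_ -> -> ->].
    * exact: rest_c_eq0 rx0 _ ni.
    * by apply: cxt => //; move: ni; rewrite !inE !negb_or => /and4P [_ _ -> ->].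
  exists 2%N; first split.
  + by exists x.
  + move=> i; have := cov i; rewrite 2!inE => /or3P [/eqP ->|/eqP ->|].
    * by rewrite c1k.
    * by rewrite c1.
    * by case/lab.
  split.
    move=> i; have := cov i; rewrite 2!inE => /or3P [/eqP ->|/eqP ->|].
    * by rewrite c1k dk.
    * by rewrite c1 dj.
    * by case/lab.
  apply: TypeD => //; rewrite (size_enum pT) //=.
  have pT' : perm_eq (j :: [:: k] ++ x :: t) (enum T).
    by apply: perm_trans pT; apply/permPl/(perm_catCA [:: j] [:: k]).
  rewrite -(detseq_perm _ pT') detseq_attach; first last.
  + move=> z; rewrite inE => /predU1P [-> //|zt].
    exact: (frontier_b_new fxt jxt).
  + by rewrite /= inE negb_or eq_sym kj.
  have [-> _] := det_chain_cons fxt kxt bkx1 bxk Dxt.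
  rewrite [_ ++ _]/= detseq_disconnected; first last.
  + exact: (frontier_b_new fxt kxt).
  + by move: kxt; rewrite inE negb_or => /andP [].
  have [_ ->] := Dxt; rewrite bjx1 bxj mul1n /=.
  rewrite geomSr (geomS (size t).+1); ring.
have rx0 : rest_sum (fun k => b x k * c k)%N (j :: x :: t) = 0%N by lia.
have fj := frontier_cons fxt jxt (rest_c_eq0 rx0).
(* As [b j x * d j = 2], the node [j] is either long again or the short end of type B. *)
have [b1|b2] : b j x = 1%N \/ b j x = 2%N by nia.
- apply: (IH j (x :: t)) => //.
  + by have := szT _ (proj1 fj); move: leTn => /=; lia.
  + exact: det_chain_cons.
  + by lia.
  + by move=> z; rewrite inE => /predU1P [->|/lab //]; lia.
  + by move=> i; rewrite inE negb_or => /andP [_ /v0].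
  + by lia.
have rj0 : rest_sum (fun k => b j k * c k)%N (j :: x :: t) = 0%N by lia.
have [pT cov] := frontier_all fj (rest_c_eq0 rj0).
exists 2%N; first split.
+ by exists x.
+ by move=> i; have := cov i; rewrite inE => /predU1P [->|/lab []] //; lia.
split.
  by move=> i; have := cov i; rewrite inE => /predU1P [->|/lab []] //; lia.
apply: TypeBC => //; first exact: md_card md.
by rewrite -(detseq_perm _ pT) (size_enum pT) (detseq_double fxt jxt) ?bxj ?b2.
Qed.


Local Ltac only_nat := repeat match goal with
  | H : @eq nat _ _ |- _ => revert H
  | H : is_true (leq _ _) |- _ => revert H
  | H : is_true (leq _ _ && leq _ _) |- _ => revert H
  end; clear; simpl.
Local Ltac nat_lia := only_nat; lia.
Local Ltac nat_nia := only_nat; nia.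
Local Ltac notin_sub H := apply: contra H; rewrite !inE; (repeat case/orP);
  move=> ->; rewrite ?orbT //.

(* A long [x] of label [k] on the stem 2, 3, ..., k whose two further
   neighbours [j], [j'] carry labels adding up to [k + 1]: the labels of their
   arms must decrease fast enough to leave only E6, E7 and E8. *)
Lemma stem_branch x t j j' : frontier x t -> det_chain x t ->
    c x = (size t).+2 -> d x = (size t).+2 -> (0 < size t)%N ->
    {in x :: t, forall z, c z <= c x /\ c z <= 2 * d z}%N ->
    (forall i, i \notin x :: t -> v i = 0%N) ->
    j \notin x :: t -> j' \notin j :: x :: t ->
    [/\ b x j = 1, b j x = 1 & d j = c j]%N ->
    [/\ b x j' = 1, b j' x = 1 & d j' = c j']%N ->
    (forall i, i \notin j' :: j :: x :: t -> b x i = 0%N) ->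
    (c j + c j' = c x + 1)%N -> (c j <= c j')%N ->
  ordinary.
Proof.
move=> fxt [D1 D2] cx dx t0 lab v0 jxt jn' [bxj bjx dj] [bxj' bjx' dj'] bx cc cle.
have [uxt cxt] := fxt.
have jxt' : j' \notin x :: t by notin_sub jn'.
have jj' : j' != j by move: jn'; rewrite inE negb_or => /andP [].
have rj := rest_c fxt jxt (v0 j jxt); have rj' := rest_c fxt jxt' (v0 j' jxt').
rewrite bjx mul1n in rj; rewrite bjx' mul1n in rj'.
have bt i : i \notin x :: t -> {in t, forall z, b i z = 0%N}.
  exact: frontier_b_new.
have Dj' : detseq M (j' :: x :: t) = geom (size t).+3.
  by have [] := det_chain_cons fxt jxt' bjx' bxj' (conj D1 D2).
have Dj't : detseq M (j' :: t) = (X + 1) * geom (size t).+1.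
  by rewrite detseq_disconnected ?D2 //; [notin_sub jxt'|exact: bt].
have attach1 i a u : i \notin a :: u -> b i a = 1%N -> b a i = 1%N ->
    {in u, forall z, b i z = 0%N} ->
    detseq M (i :: a :: u) = (X + 1) * detseq M (a :: u) - X * detseq M u.
  move=> ni bia bai biu; rewrite (@detseq_attach i [::]) //.
  by rewrite bia bai mul1r.
(* Adding the harmonic equations at [j] and [j'] leaves 2 for the nodes beyond them; as
   [c j <= c j'], it is shared as 0 + 2 or 1 + 1. *)
have [[r0 r2]|[r1 r1']] :
    (rest_sum (fun k => b j k * c k)%N (j :: x :: t) = 0 /\
     rest_sum (fun k => b j' k * c k)%N (j' :: x :: t) = 2)%N \/
    (rest_sum (fun k => b j k * c k)%N (j :: x :: t) = 1 /\
     rest_sum (fun k => b j' k * c k)%N (j' :: x :: t) = 1)%N by nat_lia.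
- have [|m [mn bjm cm bmj E]] := @long_pick j' (j' :: x :: t) (esym dj').
    by rewrite r2.
  have mxt : m \notin x :: t by notin_sub mn.
  have mj : m != j.
    apply: contraTneq isT => mj; have := rest_c_eq0 r0 jn'.
    by move/b_eq0; rewrite -mj bjm.
  have mj' : m != j' by move: mn; rewrite inE negb_or => /andP [].
  have mall : m \notin j' :: j :: x :: t by rewrite !inE !negb_or mj mj' -negb_or.
  have bxm := bx m mall; have bmx := b_eq0 bxm.
  have rm := rest_c fxt mxt (v0 m mxt).
  have jnm : j' \notin m :: x :: t by rewrite inE negb_or eq_sym mj'.
  rewrite bmx mul0n (rest_sum_cons _ jnm) add0n in rm.
  (* [c m] is at most 2, while [2 * c m >= c j' >= 3]. *)
  have c2 : c m = 2%N by have := c_gt0 m; rewrite r2 in E; nat_nia.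
  have b1 : b m j' = 1%N by rewrite c2 in rm; nat_nia.
  have d2 : d m = 2%N by nat_lia.
  have rj0 : rest_sum (fun k => b j' k * c k)%N (m :: j' :: x :: t) = 0%N by nat_lia.
  have bjj : b j j' = 0%N by exact: rest_c_eq0 r0 _ jn'.
  have bjmz : b j m = 0%N.
    by apply: rest_c_eq0 r0 _ _; rewrite inE negb_or mj.
  rewrite b1 c2 mul1n in rm.
  have Dm : detseq M (m :: j' :: x :: t) = (X + 1) * geom (size t).+3
      - X * geom (size t).+2.
    rewrite attach1 ?Dj' ?D1 // => z; rewrite inE => /predU1P [->//|].
    exact: bt.
  have Dmt : detseq M (m :: j' :: t) = (X + 1) * ((X + 1) * geom (size t).+1)
      - X * geom (size t).+1.
    by rewrite attach1 ?Dj't ?D2 //; [notin_sub mn|exact: bt].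
  (* [2 * c j' = c x + 2] and [3 <= c j' <= 2 * c m = 4], so [c x] is 4 (type E7) or 6 (type E8). *)
  have [k4|k6] : (size t = 2 \/ size t = 4)%N by nat_lia.
  + have rm1 : rest_sum (fun k => b m k * c k)%N (j' :: m :: x :: t) = 1%N by nat_lia.
    have [|n [nn bmn cn bnm E']] := @long_pick m (j' :: m :: x :: t)
      (etrans c2 (esym d2)); first by rewrite rm1.
    have c1 : c n = 1%N by have := c_gt0 n; nat_lia.
    have [d1 b1'] : d n = 1%N /\ b n m = 1%N by have := md_d_gt0 md n; nat_nia.
    have nxt : n \notin x :: t by notin_sub nn.
    have nj : n != j.
      by apply: contraTneq isT => nj; move: (b_eq0 bjmz); rewrite -nj bmn.
    have nj' : n != j' by move: nn; rewrite inE negb_or => /andP [].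
    have nm : n != m by move: nn; rewrite !inE !negb_or => /and4P [].
    have nall : n \notin j' :: j :: x :: t.
      by rewrite !inE !negb_or nj nj' -negb_or.
    have bnx := b_eq0 (bx n nall).
    have rn := rest_c fxt nxt (v0 n nxt).
    have mnn : m \notin n :: x :: t by rewrite inE negb_or eq_sym nm.
    rewrite bnx mul0n (rest_sum_cons _ mnn) add0n b1' c1 c2 in rn.
    have rn0 : rest_sum (fun k => b n k * c k)%N (m :: n :: x :: t) = 0%N by nat_lia.
    have rm0 : rest_sum (fun k => b m k * c k)%N (n :: j' :: m :: x :: t) = 0%N.
      by nat_lia.
    have bjn : b j n = 0%N.
      by apply: rest_c_eq0 r0 _ _; rewrite inE negb_or nj.
    have bjn' : b j' n = 0%N.
      by apply: rest_c_eq0 rj0 _ _; rewrite !inE !negb_or nj' nm -negb_or.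
    have us : uniq (j :: n :: m :: j' :: x :: t).
      rewrite 2!cons_uniq -[_ && uniq (m :: _)]/(_ && (_ && uniq (j' :: x :: t))).
      rewrite mn cons_uniq jxt' uxt !andbT; apply/andP; split.
        by rewrite !inE !negb_or eq_sym nj eq_sym mj eq_sym jj' -negb_or.
      by rewrite !inE !negb_or nm nj' -negb_or.
    have [|||pT cov] := @closed_all (j :: n :: m :: j' :: x :: t) j.
    * exact: mem_head.
    * by [].
    * move=> y i; rewrite 5!inE => /or4P [/eqP->|/eqP->|/eqP->|] => [ni|ni|ni|].
      - by apply: rest_c_eq0 r0 _ _; notin_sub ni.
      - by apply: rest_c_eq0 rn0 _ _; notin_sub ni.
      - by apply: rest_c_eq0 rm0 _ _; notin_sub ni.
      case/or3P=> [/eqP->|/eqP->|yt] ni.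
      - by apply: rest_c_eq0 rj0 _ _; notin_sub ni.
      - by apply: bx; notin_sub ni.
      by apply: cxt => //; notin_sub ni.
    have labT i : (c i <= 4)%N /\ (c i <= 2 * d i)%N.
      have := cov i; rewrite 4!inE => /or4P [/eqP->|/eqP->|/eqP->|].
      - by nat_lia.
      - by nat_lia.
      - by nat_lia.
      by rewrite inE => /predU1P [->|/lab]; nat_lia.
    exists 4%N; first by split=> [|i]; [exists x; nat_lia|case: (labT i)].
    split=> [i|]; first by case: (labT i).
    apply: TypeE7 => //; first by rewrite (size_enum pT) /= k4.
    rewrite -(detseq_perm _ pT) (@detseq_attach j [:: n; m; j']) ?bxj ?bjx.
    * rewrite [_ ++ x :: t]/= attach1 ?Dm ?Dj' // => [||z]; last first.
      - rewrite !inE => /or3P [/eqP->|/eqP->|]; [exact: b_eq0|by []|exact: bt].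
      - by rewrite !inE !negb_or nm nj' -negb_or.
      rewrite [_ ++ t]/= attach1 ?Dmt ?Dj't // => [||z]; last first.
      - by rewrite inE => /predU1P [->|]; [exact: b_eq0|exact: bt].
      - have := nxt; rewrite !inE !negb_or nm nj'; by case/andP.
      by rewrite k4 !(geomSr, geom0); ring.
    * by case/andP: us.
    * move=> z; rewrite !inE => /or4P [/eqP->|/eqP->|/eqP->|] //.
      exact: bt.
  have rm0 : rest_sum (fun k => b m k * c k)%N (j' :: m :: x :: t) = 0%N by nat_lia.
  have us : uniq (j :: m :: j' :: x :: t).
    rewrite 2!cons_uniq mn cons_uniq jxt' uxt !andbT.
    by rewrite !inE !negb_or eq_sym mj eq_sym jj' -negb_or.
  have [|||pT cov] := @closed_all (j :: m :: j' :: x :: t) j.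
  + exact: mem_head.
  + by [].
  + move=> y i; rewrite 3!inE => /or4P [/eqP->|/eqP->|/eqP->|] => [ni|ni|ni|].
    * by apply: rest_c_eq0 r0 _ _; notin_sub ni.
    * by apply: rest_c_eq0 rm0 _ _; notin_sub ni.
    * by apply: rest_c_eq0 rj0 _ _; notin_sub ni.
    rewrite inE => /predU1P [->|yt] ni.
    * by apply: bx; notin_sub ni.
    by apply: cxt => //; notin_sub ni.
  have labT i : (c i <= 6)%N /\ (c i <= 2 * d i)%N.
    have := cov i; rewrite 3!inE => /or4P [/eqP->|/eqP->|/eqP->|/lab]; nat_lia.
  exists 6%N; first by split=> [|i]; [exists x; nat_lia|case: (labT i)].
  split=> [i|]; first by case: (labT i).
  apply: TypeE8 => //; first by rewrite (size_enum pT) /= k6.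
  rewrite -(detseq_perm _ pT) (@detseq_attach j [:: m; j']) ?bxj ?bjx.
  + rewrite [_ ++ x :: t]/= [_ ++ t]/= Dm Dmt.
    by rewrite k6 !(geomSr, geom0); ring.
  + by case/andP: us.
  + by move=> z; rewrite !inE => /or3P [/eqP->|/eqP->|] //; exact: bt.
have c2 : (c j = c j')%N by nat_lia.
have [|m [mn bjm cm bmj E]] := @long_pick j (j :: x :: t) (esym dj).
  by rewrite r1.
have [|m' [mn' bjm' cm' bmj' E']] := @long_pick j' (j' :: x :: t) (esym dj').
  by rewrite r1'.
have c1 : c m = 1%N by have := c_gt0 m; nat_lia.
have [d1 b1] : d m = 1%N /\ b m j = 1%N by have := md_d_gt0 md m; nat_nia.
have c1' : c m' = 1%N by have := c_gt0 m'; nat_lia.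
have [d1' b1'] : d m' = 1%N /\ b m' j' = 1%N by have := md_d_gt0 md m'; nat_nia.
have mj' : m != j' by apply: contraTneq isT => mj; move: c1; rewrite mj; nat_lia.
have mj2 : m' != j by apply: contraTneq isT => mj; move: c1'; rewrite mj; nat_lia.
have mj : m != j by move: mn; rewrite inE negb_or => /andP [].
have mj2' : m' != j' by move: mn'; rewrite inE negb_or => /andP [].
have mxt : m \notin x :: t by notin_sub mn.
have mxt' : m' \notin x :: t by notin_sub mn'.
have bmx : b m x = 0%N.
  by apply/b_eq0/bx; rewrite !inE !negb_or mj mj' -negb_or.
have bmx' : b m' x = 0%N.
  by apply/b_eq0/bx; rewrite !inE !negb_or mj2 mj2' -negb_or.
have rm := rest_c fxt mxt (v0 m mxt); have rm' := rest_c fxt mxt' (v0 m' mxt').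
have jnm : j \notin m :: x :: t by rewrite inE negb_or eq_sym mj.
have jnm' : j' \notin m' :: x :: t by rewrite inE negb_or eq_sym mj2'.
rewrite bmx mul0n (rest_sum_cons _ jnm) add0n b1 c1 in rm.
rewrite bmx' mul0n (rest_sum_cons _ jnm') add0n b1' c1' in rm'.
(* [c j <= 2 * c m = 2] and [2 * c j = c x + 1] leave only [c x = 3], which is type E6. *)
have k3 : size t = 1%N by nat_lia.
have rm0 : rest_sum (fun k => b m k * c k)%N (j :: m :: x :: t) = 0%N by nat_lia.
have rm0' : rest_sum (fun k => b m' k * c k)%N (j' :: m' :: x :: t) = 0%N by nat_lia.
have rj0 : rest_sum (fun k => b j k * c k)%N (m :: j :: x :: t) = 0%N by nat_lia.
have rj0' : rest_sum (fun k => b j' k * c k)%N (m' :: j' :: x :: t) = 0%N by nat_lia.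
have bmj2 : b m j' = 0%N.
  by apply: rest_c_eq0 rm0 _ _; rewrite !inE !negb_or jj' eq_sym mj' -negb_or.
have mm : m' != m.
  by apply: contraTneq isT => mm; move: (b_eq0 bmj2); rewrite -mm bjm'.
have bmm : b m m' = 0%N.
  by apply: rest_c_eq0 rm0 _ _; rewrite !inE !negb_or mj2 mm -negb_or.
have bjm2 : b j m' = 0%N.
  by apply: rest_c_eq0 rj0 _ _; rewrite !inE !negb_or mj2 mm -negb_or.
have bjj : b j j' = 0%N.
  by apply: rest_c_eq0 rj0 _ _; rewrite !inE !negb_or jj' eq_sym mj' -negb_or.
have us1 : uniq (j :: m' :: j' :: x :: t).
  rewrite 2!cons_uniq mn' cons_uniq jxt' uxt !andbT.
  by rewrite !inE !negb_or eq_sym mj2 eq_sym jj' -negb_or.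
have us : uniq (m :: j :: m' :: j' :: x :: t).
  by rewrite cons_uniq us1 !inE !negb_or mj eq_sym mm mj' -negb_or mxt.
have [|||pT cov] := @closed_all (m :: j :: m' :: j' :: x :: t) j.
+ by rewrite !inE eqxx orbT.
+ by [].
+ move=> y i; rewrite 4!inE => /or4P [/eqP->|/eqP->|/eqP->|] => [ni|ni|ni|].
  * by apply: rest_c_eq0 rm0 _ _; notin_sub ni.
  * by apply: rest_c_eq0 rj0 _ _; notin_sub ni.
  * by apply: rest_c_eq0 rm0' _ _; notin_sub ni.
  case/predU1P=> [->|]; last rewrite inE => /predU1P [->|yt]; move=> ni.
  * by apply: rest_c_eq0 rj0' _ _; notin_sub ni.
  * by apply: bx; notin_sub ni.
  by apply: cxt => //; notin_sub ni.
have labT i : (c i <= 3)%N /\ (c i <= 2 * d i)%N.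
  have := cov i; rewrite 3!inE => /or4P [/eqP->|/eqP->|/eqP->|].
  + by nat_lia.
  + by nat_lia.
  + by nat_lia.
  by rewrite inE => /predU1P [->|/lab]; nat_lia.
exists 3%N; first by split=> [|i]; [exists x; nat_lia|case: (labT i)].
split=> [i|]; first by case: (labT i).
apply: TypeE6 => //; first by rewrite (size_enum pT) /= k3.
rewrite -(detseq_perm _ pT) attach1 => [||//|//|z].
- rewrite (@detseq_attach j [:: m'; j']) ?bxj ?bjx; first last.
  + by move=> z; rewrite !inE => /or3P [/eqP->|/eqP->|] //; exact: bt.
  + by case/andP: us1.
  rewrite [_ ++ x :: t]/= attach1 ?Dj' ?D1 // => [|z]; last first.
    by rewrite inE => /predU1P [->//|]; exact: bt.
  rewrite [_ ++ t]/= attach1 ?Dj't ?D2 //; first last.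
  + exact: bt.
  + by notin_sub mn'.
  by rewrite k3 !(geomSr, geom0); ring.
- by case/andP: us.
rewrite !inE => /or4P [/eqP->|/eqP->|/eqP->|] //; exact: bt.
Qed.


(* Evenness of the label behind a double edge and the bound on the next label
   only allow a double edge on the stem 2, 3, ..., k at [k = 3] (type F4). *)
Lemma stem x t : frontier x t -> det_chain x t ->
    c x = (size t).+2 -> d x = (size t).+2 -> (0 < size t)%N ->
    {in x :: t, forall z, c z <= c x /\ c z <= 2 * d z}%N ->
    (forall j, j \notin x :: t -> v j = 0%N) ->
    rest_sum (fun k => b x k * c k)%N (x :: t) = (c x + 1)%N ->
  ordinary.
Proof.
have [n leTn] := ubnP (#|T| - size (x :: t)).
elim: n x t leTn => // n IH x t leTn fxt Dxt cx dx t0 lab v0 rx.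
have cdx : c x = d x by rewrite cx dx.
have [|j [jxt bxj cj bjx E]] := @long_pick x (x :: t) cdx; first by rewrite rx addn1.
have vj := v0 j jxt; rewrite rx in E; have rj := rest_c fxt jxt vj.
have dj0 := md_d_gt0 md j.
have [E0|E0] := posnP (rest_sum (fun k => b x k * c k)%N (j :: x :: t)).
  have fj := frontier_cons fxt jxt (rest_c_eq0 E0).
  (* Here [c j = c x + 1], and a triple edge would need [3 * c x <= 2 * c j], impossible for
     [c x >= 3]. *)
  have [b1|b2] : b j x = 1%N \/ b j x = 2%N by nat_nia.
    apply: (IH j (x :: t)) => //.
    - have : (size (j :: x :: t) <= #|T|)%N.
        by rewrite -(card_uniqP (proj1 fj)) max_card.
      by move: leTn; rewrite /=; clear; lia.
    - exact: det_chain_cons.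
    - have -> : (size (x :: t)).+2 = (c x).+1 by rewrite cx.
      by nat_lia.
    - have -> : (size (x :: t)).+2 = (c x).+1 by rewrite cx.
      by rewrite b1 in cj; nat_lia.
    - by move=> z; rewrite inE => /predU1P [->|/lab []]; nat_lia.
    - by move=> i; rewrite inE negb_or => /andP [_ /v0].
    by rewrite b1 in rj; nat_lia.
  rewrite b2 in rj cj; have rdj := rest_d fxt jxt; rewrite vj bxj mul1n in rdj.
  (* [2 * d j = c j = c x + 1 = d x + 1], so the dual equation at [j] leaves 1. *)
  have rd1 : rest_sum (fun k => b k j * d k)%N (j :: x :: t) = 1%N by nat_lia.
  have [|m [mn bm Em]] := @rest_sum_pick _ (fun k => b k j * d k)%N (j :: x :: t).
    by rewrite rd1.
  have [dm bmj] : d m = 1%N /\ b m j = 1%N.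
    by rewrite rd1 in Em; move: bm; rewrite muln_gt0 => /andP []; nat_nia.
  have mxt : m \notin x :: t by notin_sub mn.
  have symjm := md_sym md j m; rewrite bmj dm !mul1n in symjm.
  have bcm : (b j m * c m = 2)%N by nat_nia.
  have rm := rest_c fj mn (v0 m mxt); rewrite bmj mul1n in rm.
  have [bjm cm] : b j m = 1%N /\ c m = 2%N.
    have cm2 : (2 <= c m)%N by nat_lia.
    by move: bcm cm2; case: (b j m) => [|[|p]]; clear; nia.
  have rj0 : rest_sum (fun k => b j k * c k)%N (m :: j :: x :: t) = 0%N.
    have := @rest_sum_cons _ (fun k => b j k * c k)%N _ _ mn.
    by rewrite bjm cm; nat_lia.
  have rm0 : rest_sum (fun k => b m k * c k)%N (m :: j :: x :: t) = 0%N by nat_lia.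
  have fm := frontier_cons fj mn (rest_c_eq0 rj0).
  have [pT cov] := frontier_all fm (rest_c_eq0 rm0).
  (* [c x + 1 = c j <= 2 * c m = 4]. *)
  have k3 : size t = 1%N by nat_lia.
  have labT i : (c i <= 4)%N /\ (c i <= 2 * d i)%N.
    have := cov i; rewrite 2!inE => /or3P [/eqP->|/eqP->|/lab []]; nat_lia.
  exists 4%N; first by split=> [|i]; [exists j; nat_lia|case: (labT i)].
  split=> [i|]; first by case: (labT i).
  apply: TypeF4 => //; first by rewrite (size_enum pT) /= k3.
  rewrite -(detseq_perm _ pT) (detseq_extend fj mn) bmj bjm.
  rewrite (detseq_extend fxt jxt) bxj b2; case: Dxt => -> ->.
  by rewrite k3 !(geomSr, geom0); ring.
have [j' [jn' bxj' cj' bjx' E']] := long_pick cdx E0.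
have jxt' : j' \notin x :: t by notin_sub jn'.
have dj0' := md_d_gt0 md j'.
have rj' := rest_c fxt jxt' (v0 j' jxt').
have k2 : (2 < c x)%N by rewrite cx; nat_lia.
have [cjk cjk'] : (c x <= 2 * c j)%N /\ (c x <= 2 * c j')%N by nat_nia.
(* A multiple edge would give [c j >= c x], leaving at most 1 for [j'], whose label is at least
   [c x / 2 > 1]. *)
have b1 : b j x = 1%N.
  apply/eqP; rewrite eqn_leq; case/andP: bjx => -> _; rewrite andbT leqNgt.
  by apply/negP => b2; have : (2 * c x <= b j x * c x)%N; nat_nia.
have b1' : b j' x = 1%N.
  apply/eqP; rewrite eqn_leq; case/andP: bjx' => -> _; rewrite andbT leqNgt.
  by apply/negP => b2; have : (2 * c x <= b j' x * c x)%N; nat_nia.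
(* Three labels, each at least [c x / 2], would exceed [c x + 1]. *)
have E0' : rest_sum (fun k => b x k * c k)%N (j' :: j :: x :: t) = 0%N.
  apply/eqP; rewrite -leqn0 leqNgt; apply/negP => E1.
  have [j'' [jn'' bxj'' cj'' bjx'' E'']] := long_pick cdx E1.
  have jxt'' : j'' \notin x :: t by notin_sub jn''.
  have rj'' := rest_c fxt jxt'' (v0 j'' jxt'').
  have : (c x <= 2 * c j'')%N by nat_nia.
  by nat_lia.
have ccj : (c j + c j' = c x + 1)%N by nat_lia.
have dj : d j = c j by rewrite cj b1 mul1n.
have dj' : d j' = c j' by rewrite cj' b1' mul1n.
have [le|lt] := leqP (c j) (c j').
  by apply: (@stem_branch x t j j') => //; exact: rest_c_eq0.
apply: (@stem_branch x t j' j) => //.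
- have jj' : j' != j by move: jn'; rewrite inE negb_or => /andP [].
  by rewrite inE negb_or eq_sym jj'.
- by move=> i ni; apply: rest_c_eq0 E0' _ _; notin_sub ni.
- by rewrite addnC.
exact: ltnW.
Qed.

(** At a node with [v x = 1] the label is at most 2. If [d x = 1], then [chain_d1] applies.
    Otherwise [x] is long of label 2 and its neighbours' labels add up to 3. A neighbour of label 1
    is a leaf and leads to [chain_c2]; a single neighbour of label 3 starts a [stem] along a simple
    edge, or closes G2 along a triple one. *)
Lemma marked_diagram_classification : ordinary \/
  exists x y, [/\ perm_eq [:: x; y] (enum T), c x = 2, c y = 3,
    d x = 2 /\ d y = 1 & b x y = 1 /\ b y x = 3]%N.
Proof.
have [x vx] : exists x, v x = 1%N.
  have : (\sum_i c i * v i != 0)%N by rewrite (md_sum_v md).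
  rewrite sum_nat_eq0 negb_forall => /existsP [x]; rewrite /= muln_eq0 negb_or.
  by move=> /andP [_ vx]; exists x; have := md_v_le1 md x; lia.
have cx2 : (c x <= 2)%N.
  by have := md_sum_v md; rewrite (bigD1 x) //= vx muln1 => <-; rewrite leq_addr.
have [dx|dx] : d x = 1%N \/ d x = 2%N.
  by have := md_d_gt0 md x; have := md_d_le_c md x; lia.
  left; apply: (@chain_d1 x [::] x (c x)) => //; first exact: det_chain1.
  - by move=> z; rewrite inE => /eqP ->.
  - exact: mem_head.
  - rewrite rest_sum_cons0 ?(md_diag md) // rest_sum0.
    by have := md_d_eq md x; rewrite vx dx; lia.
  by have := c_gt0 x; lia.
have cx : c x = 2%N by have := md_d_le_c md x; lia.
have cdx : c x = d x by rewrite cx dx.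
have v0 j : j != x -> v j = 0%N.
  by move=> jx; apply: (@v_eq0 x); rewrite 1?eq_sym // vx cx.
have r0 : rest_sum (fun k => b x k * c k)%N [::] = 3%N.
  by rewrite rest_sum0; have := md_c_eq md x; rewrite vx cx dx; lia.
have r1 : rest_sum (fun k => b x k * c k)%N [:: x] = 3%N.
  by rewrite rest_sum_cons0 ?(md_diag md).
have fx := frontier1 x; have Dx := det_chain1 x.
have leaf z : z \notin [:: x] -> b x z = 1%N -> c z = (b z x * d z)%N ->
    c z = 1%N -> ordinary.
  move=> zx bxz cz c1; have zx' : z != x by rewrite inE in zx.
  have [bzx dz] : b z x = 1%N /\ d z = 1%N.
    move/esym/eqP: cz; rewrite c1 muln_eq1.
    by case/andP=> /eqP -> /eqP ->.
  have rz := rest_c fx zx (v0 z zx'); rewrite c1 bzx cx in rz.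
  have xz : x \notin [:: z] by rewrite inE eq_sym.
  have fz : frontier x [:: z].
    split; first by rewrite cons_uniq xz.
    move=> y k; rewrite mem_seq1 => /eqP -> kn.
    apply: (@rest_c_eq0 z [:: z; x]); first by apply: (@addnI (1 * 2)); rewrite -rz.
    by notin_sub kn.
  apply: (@chain_c2 x [:: z]) => //.
  - exact: (det_chain_cons (frontier1 z) xz bxz bzx (det_chain1 z)).
  - by move=> y; rewrite !inE => /orP [/eqP ->|/eqP ->]; nat_lia.
  - by move=> j; rewrite inE negb_or => /andP [/v0].
  rewrite rest_sum_cons0 ?(md_diag md) //.
  have := @rest_sum_cons _ (fun k => b x k * c k)%N [::] z isT.
  by rewrite bxz c1; nat_lia.
have [|j [jx bxj cj bjx E]] := @long_pick x [:: x] cdx; first by rewrite r1.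
have jx' : j != x by rewrite inE in jx.
have vj := v0 j jx'; have rj := rest_c fx jx vj; rewrite cx in rj.
have [c1|[c2|c3]] : c j = 1%N \/ c j = 2%N \/ c j = 3%N.
    by have := c_gt0 j; rewrite r1 in E; nat_lia.
- by left; apply: (leaf j).
- have [|k [kn bxk ck bkx E']] := @long_pick x [:: j; x] cdx.
    by rewrite r1 in E; nat_lia.
  left; apply: (leaf k) => //; first by notin_sub kn.
  by have := c_gt0 k; nat_lia.
have E0 : rest_sum (fun k => b x k * c k)%N [:: j; x] = 0%N by nat_lia.
have fj := frontier_cons fx jx (rest_c_eq0 E0).
have [[b1 dj]|[b3 dj]] : b j x = 1%N /\ d j = 3%N \/ b j x = 3%N /\ d j = 1%N.
- by nat_nia.
- left; apply: (@stem j [:: x]) => //.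
  + exact: det_chain_cons.
  + by move=> z; rewrite !inE => /orP [/eqP ->|/eqP ->]; nat_lia.
  + by move=> i; rewrite !inE negb_or => /andP [_ /v0].
  by rewrite b1 in rj; nat_lia.
right; exists x, j; split=> //.
have rj0 : rest_sum (fun k => b j k * c k)%N [:: j; x] = 0%N by nat_lia.
have [pT _] := frontier_all fj (rest_c_eq0 rj0).
by apply: perm_trans pT; apply/permPl/(perm_catC [:: x] [:: j]).
Qed.

End Walk.

(** * Exponents from the characteristic polynomial *)

Section CyclotomicRoots.
Variable F : fieldType.
Implicit Types (z w : F) (q : {poly F}).

Let neq_prim N w k : N.-primitive_root w -> ~~ (N %| k)%N -> w ^+ k - 1 != 0.
Proof. by move=> pw; rewrite (prim_order_dvd pw) subr_eq0. Qed.

(** [w ^+ N] is a square root of 1 other than 1. *)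
Lemma prim_half_order N w : (0 < N)%N -> (2 * N)%N.-primitive_root w ->
  w ^+ N = -1.
Proof.
move=> N0 pw; have nN : ~~ (2 * N %| N)%N by apply/negP => /(dvdn_leq N0); lia.
have /eqP : (w ^+ N - 1) * (w ^+ N + 1) = 0.
  by rewrite -subr_sqr expr1n -exprM mulnC prim_expr_order // subrr.
rewrite mulf_eq0 (negbTE (neq_prim pw nN)) /=.
by rewrite addr_eq0 => /eqP.
Qed.

(** This and the next four lemmas evaluate cyclotomic polynomials: factors that do not vanish at a
    primitive root are cancelled from [w ^+ 3 - 1], or from [w ^+ N + 1] for order [2 * N]. *)
Lemma prim3_root w : 3.-primitive_root w -> w ^+ 2 + w + 1 = 0.
Proof.
move=> pw; apply: (mulfI (neq_prim (k := 1) pw isT)).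
rewrite mulr0 expr1; transitivity (w ^+ 3 - 1); first by ring.
by rewrite prim_expr_order // subrr.
Qed.

Lemma prim6_root w : 6.-primitive_root w -> w ^+ 2 - w + 1 = 0.
Proof.
move=> pw; have E := @prim_half_order 3 w isT pw.
have w1 : w + 1 != 0.
  have := neq_prim (k := 2) pw isT; apply: contraNneq => w1.
  have -> : w ^+ 2 - 1 = (w - 1) * (w + 1) by ring.
  by rewrite w1 mulr0.
apply: (mulfI w1); rewrite mulr0.
transitivity (w ^+ 3 + 1); [by ring|by rewrite E addNr].
Qed.

Lemma prim12_root w : 12.-primitive_root w -> w ^+ 4 - w ^+ 2 + 1 = 0.
Proof.
move=> pw; have E := @prim_half_order 6 w isT pw.
have w1 : w ^+ 2 + 1 != 0.
  have := neq_prim (k := 4) pw isT; apply: contraNneq => w1.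
  have -> : w ^+ 4 - 1 = (w ^+ 2 - 1) * (w ^+ 2 + 1) by ring.
  by rewrite w1 mulr0.
apply: (mulfI w1); rewrite mulr0.
transitivity (w ^+ 6 + 1); [by ring|by rewrite E addNr].
Qed.

Lemma prim18_root w : 18.-primitive_root w -> w ^+ 6 - w ^+ 3 + 1 = 0.
Proof.
move=> pw; have E := @prim_half_order 9 w isT pw.
have w1 : w ^+ 3 + 1 != 0.
  have := neq_prim (k := 6) pw isT; apply: contraNneq => w1.
  have -> : w ^+ 6 - 1 = (w ^+ 3 - 1) * (w ^+ 3 + 1) by ring.
  by rewrite w1 mulr0.
apply: (mulfI w1); rewrite mulr0.
transitivity (w ^+ 9 + 1); [by ring|by rewrite E addNr].
Qed.

Lemma prim30_root w : 30.-primitive_root w ->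
  w ^+ 8 + w ^+ 7 - w ^+ 5 - w ^+ 4 - w ^+ 3 + w + 1 = 0.
Proof.
move=> pw; have E := @prim_half_order 15 w isT pw.
have w1 : w ^+ 2 - w + 1 != 0.
  have := neq_prim (k := 6) pw isT; apply: contraNneq => w1.
  have -> : w ^+ 6 - 1 = (w ^+ 3 - 1) * (w + 1) * (w ^+ 2 - w + 1) by ring.
  by rewrite w1 mulr0.
have w2 : w ^+ 5 + 1 != 0.
  have := neq_prim (k := 10) pw isT; apply: contraNneq => w2.
  have -> : w ^+ 10 - 1 = (w ^+ 5 - 1) * (w ^+ 5 + 1) by ring.
  by rewrite w2 mulr0.
apply: (mulfI w1); apply: (mulfI w2).
rewrite !mulr0.
transitivity (w ^+ 15 + 1); [by ring|by rewrite E addNr].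
Qed.

(** Distinct exponents below [N] give distinct roots, as many as the degree. *)
Lemma prod_prim_roots N w (es : seq nat) q : N.-primitive_root w ->
    q \is monic -> size q = (size es).+1 -> uniq es ->
    {in es, forall e, (e < N)%N /\ q.[w ^+ e] = 0} ->
  q = \prod_(e <- es) ('X - (w ^+ e)%:P).
Proof.
move=> pw mq sq ues res.
rewrite [LHS](@all_roots_prod_XsubC _ _ [seq w ^+ e | e <- es]).
- by rewrite (monicP mq) scale1r big_map.
- by rewrite size_map.
- by apply/allP=> _ /mapP [e ees ->]; apply/rootP; case: (res e ees).
rewrite uniq_rootsE map_inj_in_uniq // => e f ee ff /eqP.
by rewrite (eq_prim_root_expr pw) !modn_small ?(proj1 (res _ _)) // => /eqP.
Qed.

Lemma prod_odd_roots n w : (0 < n)%N -> (2 * n)%N.-primitive_root w ->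
  'X^n + 1 = \prod_(e <- [seq (2 * i).+1 | i <- iota 0 n]%N) ('X - (w ^+ e)%:P).
Proof.
move=> n0 pw; apply: (prod_prim_roots pw).
- by rewrite -polyC1 monicXnaddC.
- by rewrite -polyC1 size_XnaddC // size_map size_iota.
- by rewrite map_inj_uniq ?iota_uniq // => i j; lia.
move=> e; case/mapP=> i; rewrite mem_iota => ilt ->; split; first by lia.
rewrite !hornerE -exprM mulnC exprM (prim_half_order n0 pw).
by rewrite exprS exprM sqrrN expr1n expr1n mulr1 addNr.
Qed.

(* The exponents [1 :: k :: rest] of a Coxeter element with Coxeter number
   [N], not sorted beyond the second one. *)
Definition exponent_roots (w : nat -> F) N k q := exists rest : seq nat,
  [/\ (0 < N)%N, all (leq k) rest, all (fun e => e < N)%N (1%N :: k :: rest)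
    & q = \prod_(e <- 1%N :: k :: rest) ('X - (w N ^+ e)%:P)].

(** Each type is matched with its Coxeter number and exponents. The second exponents, 2, 3, 3, 4, 5,
    7, 5 in the order of the constructors, are all [cm + 1]. *)
Lemma diagram_type_roots (w : nat -> F) n cm q :
    (forall N, (0 < N)%N -> N.-primitive_root (w N)) ->
    q \is monic -> size q = n.+1 -> diagram_type 'X q n cm ->
  exists N, exponent_roots w N cm.+1 q.
Proof.
move=> pw mq sq; case.
- move=> n1 Eq ->; exists n.+1, (iota 3 (n - 2)).
  have En : iota 1 n = 1%N :: 2%N :: iota 3 (n - 2).
    by case: n n1 {sq Eq} => [|[|n]] // _; rewrite /= subn2.
  split=> //.
  + by apply/allP=> e; rewrite mem_iota; lia.
  + by rewrite -En; apply/allP=> e; rewrite mem_iota; lia.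
  rewrite -En; apply: prod_prim_roots (pw _ _) mq _ _ _ => //.
  + by rewrite size_iota.
  + exact: iota_uniq.
  move=> e; rewrite mem_iota => elt; split; first by lia.
  have pwn := pw n.+1 isT.
  have we : w n.+1 ^+ e - 1 != 0.
    by apply: neq_prim pwn _; apply/negP => /dvdn_leq; lia.
  apply: (mulfI we); rewrite mulr0 Eq horner_sum.
  under eq_bigr => i _ do rewrite hornerXn.
  by rewrite -subrX1 exprAC (prim_expr_order pwn) expr1n subrr.
- move=> n1 Eq ->; exists (2 * n)%N, [seq (2 * i).+1 | i <- iota 2 (n - 2)]%N.
  have En : [seq (2 * i).+1 | i <- iota 0 n]%N =
      1%N :: 3%N :: [seq (2 * i).+1 | i <- iota 2 (n - 2)]%N.
    by case: n n1 {sq Eq} => [|[|n]] // _; rewrite /= subn2.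
  split; first by lia.
  + by apply/allP=> e; case/mapP=> i; rewrite mem_iota; lia.
  + by rewrite -En; apply/allP=> e; case/mapP=> i; rewrite mem_iota; lia.
  by rewrite -En Eq; apply: prod_odd_roots; [lia|apply: pw; lia].
(* In type D the factor [X + 1] adds the exponent [n - 1], whose root is -1. *)
- move=> n1 Eq ->; exists (2 * n.-1)%N.
  exists ([seq (2 * i).+1 | i <- iota 2 (n.-1 - 2)] ++ [:: n.-1])%N.
  have En : [seq (2 * i).+1 | i <- iota 0 n.-1]%N =
      1%N :: 3%N :: [seq (2 * i).+1 | i <- iota 2 (n.-1 - 2)]%N.
    by case: n n1 {sq Eq} => [|[|[|n]]] // _; rewrite /= subn2.
  split; first by lia.
  + rewrite all_cat /= andbT; apply/andP; split; last by lia.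
    by apply/allP=> e; case/mapP=> i; rewrite mem_iota; lia.
  + rewrite -!cat_cons -En all_cat /= andbT; apply/andP; split; last by lia.
    by apply/allP=> e; case/mapP=> i; rewrite mem_iota; lia.
  rewrite -!cat_cons -En big_cat big_seq1 Eq.
  have n0 : (0 < n.-1)%N by lia.
  have pwn : (2 * n.-1)%N.-primitive_root (w (2 * n.-1)%N) by apply: pw; lia.
  by rewrite (prod_odd_roots n0 pwn) (prim_half_order n0 pwn) polyCN polyC1 opprK.
- move=> n6 Eq ->; exists 12, [:: 5; 7; 8; 11]%N; split=> //.
  have p12 := pw 12 isT.
  apply: (prod_prim_roots p12 mq) => //; first by rewrite sq n6.
  move=> e ees; split; first by move: e ees; apply/allP.
  have [e12|e12] := boolP (coprime e 12).
    have pe : 12.-primitive_root (w 12 ^+ e).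
      by rewrite (prim_root_exp_coprime e p12).
    by rewrite Eq !hornerE (prim12_root pe) mulr0.
  (* The exponents left are 4 and 8, giving the primitive cube roots of unity. *)
  have e4 : 3.-primitive_root (w 12 ^+ e).
    have p3 : 3.-primitive_root (w 12 ^+ 4) by exact: (exp_prim_root p12 4).
    move: ees e12; rewrite !inE => /or4P [/eqP->//|/eqP->//|/eqP->//|].
    case/or3P=> /eqP-> // _.
    by rewrite (exprM _ 4 2) prim_root_exp_coprime.
  by rewrite Eq !hornerE (prim3_root e4) mul0r.
- move=> n7 Eq ->; exists 18, [:: 7; 9; 11; 13; 17]%N; split=> //.
  have p18 := pw 18 isT.
  apply: (prod_prim_roots p18 mq) => //; first by rewrite sq n7.
  move=> e ees; split; first by move: e ees; apply/allP.
  have [e18|e18] := boolP (coprime e 18).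
    have pe : 18.-primitive_root (w 18 ^+ e).
      by rewrite (prim_root_exp_coprime e p18).
    by rewrite Eq !hornerE (prim18_root pe) mulr0.
  have -> : e = 9%N.
    move: ees e18; rewrite !inE => /or4P [/eqP->//|/eqP->//|/eqP->//|].
    by case/or4P=> /eqP->.
  by rewrite Eq !hornerE (@prim_half_order 9 _ isT p18) addNr mul0r.
- move=> n8 Eq ->; exists 30, [:: 11; 13; 17; 19; 23; 29]%N; split=> //.
  have p30 := pw 30 isT.
  apply: (prod_prim_roots p30 mq) => //; first by rewrite sq n8.
  move=> e ees; split; first by move: e ees; apply/allP.
  have e30 : coprime e 30 by move: e ees; apply/allP.
  have pe : 30.-primitive_root (w 30 ^+ e).
      by rewrite (prim_root_exp_coprime e p30).
  by rewrite Eq !hornerE (prim30_root pe).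
move=> n4 Eq ->; exists 12, [:: 7; 11]%N; split=> //.
have p12 := pw 12 isT.
apply: (prod_prim_roots p12 mq) => //; first by rewrite sq n4.
move=> e ees; split; first by move: e ees; apply/allP.
have e12 : coprime e 12 by move: e ees; apply/allP.
have pe : 12.-primitive_root (w 12 ^+ e).
      by rewrite (prim_root_exp_coprime e p12).
  by rewrite Eq !hornerE (prim12_root pe).
Qed.

Lemma G2_roots (w : nat -> F) q :
    (forall N, (0 < N)%N -> N.-primitive_root (w N)) ->
    q \is monic -> size q = 3%N -> q = 'X^2 - 'X + 1 ->
  exponent_roots w 6 5 q.
Proof.
move=> pw mq sq Eq; exists [::]; split=> //.
have p6 := pw 6 isT.
apply: (prod_prim_roots p6 mq) => //.
move=> e ees; split; first by move: e ees; apply/allP.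
have e6 : coprime e 6 by move: e ees; apply/allP.
have pe : 6.-primitive_root (w 6 ^+ e).
      by rewrite (prim_root_exp_coprime e p6).
  by rewrite Eq !hornerE (prim6_root pe).
Qed.

End CyclotomicRoots.

(** * Complex roots of unity and the order of a matrix *)

Section Expi.
Variable R : realType.

Lemma expiD (x y : R) : expi (x + y) = expi x * expi y.
Proof.
apply/eqP; rewrite /expi cosD sinD eq_complex /= eqxx /=.
by apply/eqP; ring.
Qed.

Lemma expi0 : expi (0 : R) = 1.
Proof. by rewrite /expi cos0 sin0. Qed.

Lemma expiMn (x : R) n : expi (x *+ n) = expi x ^+ n.
Proof. by elim: n => [|n IH]; rewrite ?expi0 // mulrS expiD IH exprS. Qed.

Lemma expi2pi : expi (2 * pi : R) = 1.
Proof. by rewrite mulr_natl /expi cos2pi sin2pi. Qed.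

(** [1 - cos x] is twice the square of [sin (x / 2)], which is positive. *)
Lemma cos_lt1 (x : R) : 0 < x -> x < 2 * pi -> cos x != 1.
Proof.
move=> x0 x2; have s0 : 0 < sin (x / 2) by rewrite sin_gt0_pi //; lra.
have -> : x = x / 2 *+ 2 by rewrite -mulr_natr; field.
rewrite cos_mulr2n -subr_eq0; have := cos2Dsin2 (x / 2).
by move=> E; have : 0 < sin (x / 2) ^+ 2 by [rewrite exprn_gt0|]; lra.
Qed.

Definition unity_root N : R[i] := expi (2 * pi / N%:R).

Lemma unity_rootX N e : unity_root N ^+ e = expi (2 * pi * e%:R / N%:R).
Proof. by rewrite -expiMn -[(_ / _) *+ e]mulr_natr mulrAC. Qed.

(** An order [k < N] would make the cosine of [2 * pi * k / N] equal to 1. *)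
Lemma unity_root_prim N : (0 < N)%N -> N.-primitive_root (unity_root N).
Proof.
move=> N0; have NR : 0 < N%:R :> R by rewrite ltr0n.
have wN : unity_root N ^+ N = 1.
  by rewrite unity_rootX mulfK ?expi2pi // gt_eqF.
have [k kN kd] := prim_order_exists N0 wN.
suff E : N = k by rewrite {1}E.
apply/eqP; rewrite eqn_leq [(k <= N)%N]dvdn_leq // andbT leqNgt; apply/negP => ltkN.
have k0 : (0 < k)%N := prim_order_gt0 kN.
have := prim_expr_order kN; rewrite unity_rootX => -[/eqP c1 _].
have pi0 := pi_gt0 R.
have xN : 0 < k%:R / N%:R :> R by rewrite divr_gt0 ?ltr0n.
have xN1 : k%:R / N%:R < 1 :> R by rewrite ltr_pdivrMr // mul1r ltr_nat.
move: c1; rewrite (negbTE (cos_lt1 _ _)) // -mulrA.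
  by rewrite mulr_gt0 // mulr_gt0.
by rewrite -[ltRHS]mulr1 ltr_pM2l // mulr_gt0.
Qed.

End Expi.

(** Since [A ^+ h = 1], the minimal polynomial divides [X^h - 1] and is a product of distinct linear
    factors. Their roots are eigenvalues, hence [N]-th roots of unity, so it divides [X^N - 1] as
    well. *)
Lemma mx_exp_eq1 (F : fieldType) n (A : 'M[F]_n.+1) (h N : nat) (w : F) :
    h.-primitive_root w -> A ^+ h = 1 ->
    (forall z, root (char_poly A) z -> z ^+ N = 1) ->
  A ^+ N = 1.
Proof.
move=> pw Ah rootN.
have hX k : horner_mx A ('X^k - 1) = A ^+ k - 1.
  by rewrite rmorphB rmorphXn /= horner_mx_X rmorph1.
have pX : mxminpoly A %| \prod_(i <- index_iota 0 h) ('X - (w ^+ i)%:P).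
  by rewrite factor_Xn_sub_1 // mxminpoly_min // hX Ah subrr.
have [s ps] := dvdp_prod_XsubC pX.
have pN : mxminpoly A %| 'X^N - 1.
  rewrite (eqp_dvdl _ ps) -(big_map _ xpredT (fun z => 'X - z%:P)).
  apply: uniq_roots_dvdp.
    apply/allP=> _ /mapP [i im ->].
    rewrite rootE !hornerE subr_eq0; apply/eqP/rootN.
    apply: root_dvdp (mxminpoly_dvd_char A) _; rewrite (eqp_root ps).
    rewrite -(big_map _ xpredT (fun z => 'X - z%:P)) root_prod_XsubC.
    exact: map_f.
  rewrite uniq_rootsE map_inj_in_uniq ?mask_uniq ?iota_uniq // => i j.
  move=> /mem_mask; rewrite mem_index_iota => ih.
  move=> /mem_mask; rewrite mem_index_iota => jh /eqP.
  by rewrite (eq_prim_root_expr pw) !modn_small // => /eqP.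
have /dvdpP [q Eq] := pN; apply/eqP; rewrite -subr_eq0 -hX Eq rmorphM /=.
by rewrite mx_root_minpoly mulr0.
Qed.

Lemma perm_eq_sorted_head (a1 a2 b1 b2 : nat) (s t : seq nat) :
    perm_eq [:: a1, a2 & s] [:: b1, b2 & t] ->
    (a1 <= a2)%N -> all (leq a2) s -> (b1 <= b2)%N -> all (leq b2) t ->
  a1 = b1 /\ a2 = b2.
Proof.
move=> pst a12 as_ b12 bt.
have min (u v : seq nat) x y : perm_eq (x :: u) (y :: v) ->
    all (leq x) u -> (x <= y)%N.
  move=> puv xu; have : y \in x :: u by rewrite (perm_mem puv) mem_head.
  by rewrite inE => /predU1P [->//|/(allP xu)].
have le_all x y (u : seq nat) : (x <= y)%N -> all (leq y) u -> all (leq x) (y :: u).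
  move=> xy yu; rewrite /= xy; apply: sub_all yu => z; exact: leq_trans.
have E1 : a1 = b1.
  apply/eqP; rewrite eqn_leq (min _ _ _ _ pst) ?le_all //=.
  by rewrite perm_sym in pst; rewrite (min _ _ _ _ pst) ?le_all.
move: pst; rewrite E1 perm_cons => pst; split=> //.
apply/eqP; rewrite eqn_leq (min _ _ _ _ pst) //=.
by rewrite perm_sym in pst; rewrite (min _ _ _ _ pst).
Qed.

(** Both factorizations are written in powers of one primitive root of order [N * h], so the
    [N * m j] and the [h * e] agree up to order. The two smallest give [N * m 1 = h] and
    [N * m 2 = h * k]. The first yields [N <= h]; [A ^+ N = 1] and the minimality of [h] yield
    [h <= N]. *)
Lemma first_exponents (R : realType) n (A : 'M[R]_n.+2) (h N k : nat)
    (m : nat -> nat) :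
    (0 < h)%N -> A ^+ h = 1 -> (forall i, (0 < i < h)%N -> A ^+ i <> 1) ->
    (forall j, (1 <= j <= n.+2)%N -> (0 < m j < h)%N) ->
    (forall i j, (1 <= i)%N -> (i <= j)%N -> (j <= n.+2)%N -> (m i <= m j)%N) ->
    map_poly (real_complex R) (char_poly A) =
      \prod_(1 <= j < n.+3) ('X - (expi (2 * pi * (m j)%:R / h%:R))%:P) ->
    (0 < k)%N -> exponent_roots (@unity_root R) N k
      (map_poly (real_complex R) (char_poly A)) ->
  m 1%N = 1%N /\ m 2%N = k.
Proof.
move=> h0 Ah Amin mh msort Em k0 [rest [N0 rest_k rest_N EN]].
set es := [:: 1, k & rest]%N in rest_N EN.
have Nh0 : (0 < N * h)%N by rewrite muln_gt0 N0.
pose z : R[i] := unity_root R (N * h); have pz := unity_root_prim R Nh0.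
have hR : h%:R != 0 :> R by rewrite pnatr_eq0 -lt0n.
have NR : N%:R != 0 :> R by rewrite pnatr_eq0 -lt0n.
have zm j : expi (2 * pi * (m j)%:R / h%:R) = z ^+ (N * m j)%N.
  rewrite unity_rootX; congr (expi _); rewrite !natrM; field.
  by rewrite hR NR.
have ze e : unity_root R N ^+ e = z ^+ (h * e)%N.
  rewrite !unity_rootX; congr (expi _); rewrite !natrM; field.
  by rewrite hR NR.
have pC : perm_eq [seq z ^+ i | i <- [seq N * m j | j <- index_iota 1 n.+3]]%N
    [seq z ^+ i | i <- [seq h * e | e <- es]]%N.
  apply: prod_XsubC_eq; rewrite !big_map; rewrite EN in Em.
  under eq_bigr => j _ do rewrite -zm.
  by rewrite -Em; apply: eq_bigr => e _; rewrite ze.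
(* A discrete logarithm to base [z], exact for exponents below [N * h]. *)
pose lg (x : R[i]) := index x [seq z ^+ i | i <- iota 0 (N * h)].
have lgK s : all (fun i => i < N * h)%N s -> map lg (map (GRing.exp z) s) = s.
  move=> /allP sN; rewrite -map_comp map_id_in // => i /sN iN /=.
  have iN' : (i < size [seq z ^+ i | i <- iota 0 (N * h)])%N.
    by rewrite size_map size_iota.
  have nth_i : nth 0 [seq z ^+ i | i <- iota 0 (N * h)] i = z ^+ i.
    by rewrite (nth_map 0%N) ?size_iota // nth_iota.
  rewrite /lg -nth_i index_uniq // map_inj_in_uniq ?iota_uniq // => a b.
  rewrite !mem_iota => aN bN /eqP.
  by rewrite (eq_prim_root_expr pz) !modn_small // => /eqP.
have pN : perm_eq [seq N * m j | j <- index_iota 1 n.+3]%N [seq h * e | e <- es]%N.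
  have := perm_map lg pC; rewrite !lgK //.
    apply/allP=> x; case/mapP=> e ees ->; rewrite mulnC ltn_pmul2r //.
    by move: e ees; apply/allP.
  apply/allP=> x; case/mapP=> j; rewrite mem_index_iota => jn ->.
  by rewrite ltn_pmul2l //; case/andP: (mh j jn).
have [E1 E2] : (N * m 1 = h * 1 /\ N * m 2 = h * k)%N.
  apply: (@perm_eq_sorted_head _ _ _ _ [seq N * m j | j <- iota 3 n]%N
    [seq h * e | e <- rest]%N pN); rewrite ?leq_pmul2l //.
  - exact: msort.
  - apply/allP=> x; case/mapP=> j; rewrite mem_iota => jn ->.
    by rewrite leq_pmul2l // msort //; lia.
  by apply/allP=> x; case/mapP=> e /(allP rest_k) ke ->; rewrite leq_pmul2l.
have m1 : (0 < m 1)%N by case/andP: (mh 1%N isT).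
have AN : A ^+ N = 1.
  apply: (map_mx_inj (f := real_complex R)); rewrite rmorphXn rmorph1 /=.
  apply: (mx_exp_eq1 (unity_root_prim R h0)); first by rewrite -rmorphXn /= Ah rmorph1.
  move=> x; rewrite -map_char_poly EN -(big_map _ xpredT (fun z => 'X - z%:P)).
  rewrite root_prod_XsubC => /mapP [e _ ->].
  by rewrite exprAC (prim_expr_order (unity_root_prim R N0)) expr1n.
have hN : h = N.
  have [||//] := ltngtP h N; last by move=> Nh; case: (Amin N); rewrite ?N0.
  by move=> hN; move: E1; rewrite muln1; nia.
move: E1 E2; rewrite hN => /eqP; rewrite eqn_pmul2l // => /eqP -> /eqP.
by rewrite eqn_pmul2l // => /eqP.
Qed.

(** * The characteristic polynomial of a Coxeter element *)

Section Inner.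
Variables (R : realType) (l : nat).
Implicit Types b u v w : 'rV[R]_l.

Lemma innerC u v : inner u v = inner v u.
Proof. by apply: eq_bigr => i _; rewrite mulrC. Qed.

Lemma innerDl u v w : inner (u + v) w = inner u w + inner v w.
Proof. by rewrite -big_split; apply: eq_bigr => i _; rewrite mxE mulrDl. Qed.

Lemma innerZl c u v : inner (c *: u) v = c * inner u v.
Proof. by rewrite mulr_sumr; apply: eq_bigr => i _; rewrite mxE mulrA. Qed.

Lemma innerNl u v : inner (- u) v = - inner u v.
Proof. by rewrite -scaleN1r innerZl mulN1r. Qed.

Lemma inner_suml I (r : seq I) (P : pred I) (F : I -> 'rV[R]_l) v :
  inner (\sum_(i <- r | P i) F i) v = \sum_(i <- r | P i) inner (F i) v.
Proof.
elim/big_rec2: _ => [|i x y _ <-]; last exact: innerDl.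
by rewrite -(scale0r 0) innerZl mul0r.
Qed.

Lemma innerDr u v w : inner w (u + v) = inner w u + inner w v.
Proof. by rewrite innerC innerDl !(innerC _ w). Qed.

Lemma innerZr c u v : inner u (c *: v) = c * inner u v.
Proof. by rewrite innerC innerZl innerC. Qed.

Lemma innerNr u v : inner u (- v) = - inner u v.
Proof. by rewrite innerC innerNl innerC. Qed.

Lemma inner_ge0 v : 0 <= inner v v.
Proof. by apply: sumr_ge0 => i _; rewrite -expr2 sqr_ge0. Qed.

Lemma inner_eq0 v : (inner v v == 0) = (v == 0).
Proof.
apply/idP/eqP => [|->]; last by rewrite -(scale0r 0) innerZl mul0r.
rewrite psumr_eq0 => [/allP v0|i _]; last by rewrite -expr2 sqr_ge0.
apply/rowP=> i; rewrite mxE; apply/eqP.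
by have := v0 i (mem_index_enum i); rewrite mulf_eq0 orbb.
Qed.

Lemma inner_gt0 v : v != 0 -> 0 < inner v v.
Proof. by move=> v0; rewrite lt0r inner_eq0 v0 inner_ge0. Qed.

Lemma pairing_suml I (r : seq I) (P : pred I) (F : I -> R) (G : I -> 'rV[R]_l) v :
  pairing (\sum_(i <- r | P i) F i *: G i) v
    = \sum_(i <- r | P i) F i * pairing (G i) v.
Proof.
rewrite /pairing inner_suml mulr_sumr mulr_suml; apply: eq_bigr => i _.
by rewrite innerZl; ring.
Qed.

Lemma pairingBl u v w : pairing (u - v) w = pairing u w - pairing v w.
Proof. by rewrite /pairing innerDl innerNl; ring. Qed.

Lemma pairingZl c u v : pairing (c *: u) v = c * pairing u v.
Proof. by rewrite /pairing innerZl; ring. Qed.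

Lemma pairingvv v : v != 0 -> pairing v v = 2.
Proof. by rewrite -inner_eq0 => v0; rewrite /pairing mulfK. Qed.

Lemma pairing_gt0 u v : v != 0 -> (0 < pairing u v) = (0 < inner u v).
Proof. by move=> v0; rewrite pmulr_lgt0 ?invr_gt0 ?inner_gt0 // pmulr_rgt0. Qed.

Lemma pairing_ge0 u v : v != 0 -> (0 <= pairing u v) = (0 <= inner u v).
Proof. by move=> v0; rewrite pmulr_lge0 ?invr_gt0 ?inner_gt0 // pmulr_rge0. Qed.

Lemma pairing_inner u v : v != 0 -> pairing u v * inner v v = 2 * inner u v.
Proof. by rewrite -inner_eq0 => v0; rewrite divfK. Qed.

Lemma inner_reflection b u : b != 0 ->
  inner (reflection b u) (reflection b u) = inner u u.
Proof.
move=> b0; rewrite /reflection innerDl !innerDr !innerNl !innerNr !innerZl !innerZr.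
rewrite (innerC b u); move: (pairing_inner u b0).
move: (pairing u b) (inner u u) (inner u b) (inner b b) => p x y z E.
suff : p * (p * z - 2 * y) = 0 by move=> E'; nra.
by rewrite E subrr mulr0.
Qed.

Lemma pairing_reflection b u : b != 0 ->
  pairing (reflection b u) b = - pairing u b.
Proof. by move=> b0; rewrite pairingBl pairingZl pairingvv //; ring. Qed.

(** The vector is the component of [u] orthogonal to [v]; its squared length gives both the weak and
    the strict inequality. *)
Lemma cauchy_schwarz_line u v : v != 0 ->
  inner v v * inner (u - (inner u v / inner v v) *: v)
                    (u - (inner u v / inner v v) *: v)
    = inner u u * inner v v - inner u v ^+ 2.
Proof.
rewrite -inner_eq0 => v0.
rewrite innerDl !innerDr !innerNl !innerNr !innerZl !innerZr (innerC v u).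
by field.
Qed.

Lemma cauchy_schwarz u v : inner u v ^+ 2 <= inner u u * inner v v.
Proof.
have [->|v0] := eqVneq v 0.
  by rewrite -(scale0r 0) !innerZr !mul0r mulr0 expr0n.
by rewrite -subr_ge0 -cauchy_schwarz_line // mulr_ge0 ?inner_ge0.
Qed.

Lemma cauchy_schwarz_lt u v : v != 0 -> (forall c, u != c *: v) ->
  inner u v ^+ 2 < inner u u * inner v v.
Proof.
move=> v0 uv; rewrite -subr_gt0 -cauchy_schwarz_line // mulr_gt0 ?inner_gt0 //.
by rewrite subr_eq0.
Qed.

End Inner.

(** * The Coxeter element in the basis of simple roots *)

Section CoxeterPolynomial.
Variables (R : realType) (l : nat) (alpha : l.-tuple 'rV[R]_l).

Lemma reflection_linear (b : 'rV[R]_l) : linear (reflection b).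
Proof.
move=> c u v; rewrite /reflection; set p := pairing _ b.
have -> : p = c * pairing u b + pairing v b.
  by rewrite /p /pairing innerDl innerZl; ring.
by apply/rowP=> i; rewrite !mxE; ring.
Qed.

Lemma coxeter_elt_linear : linear (coxeter_elt alpha).
Proof.
rewrite /coxeter_elt; elim: (tval alpha) => // b s IH c u v /=.
by rewrite IH reflection_linear.
Qed.

Lemma mul_coxeter_mx v : v *m lin1_mx (coxeter_elt alpha) = coxeter_elt alpha v.
Proof.
pose f : {linear 'rV[R]_l -> 'rV[R]_l} := HB.pack (coxeter_elt alpha)
  (GRing.isLinear.Build _ _ _ _ (coxeter_elt alpha) coxeter_elt_linear).
exact: (mul_rV_lin1 f).
Qed.

(* Peeling the reflections one at a time, the coefficients [t] solve a
   triangular linear system. *)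
Lemma coxeter_eltE (t : 'I_l -> R) v :
    (forall i, t i + \sum_(j < l | (i < j)%N) t j * pairing (tnth alpha j) (tnth alpha i)
       = pairing v (tnth alpha i)) ->
  coxeter_elt alpha v = v - \sum_i t i *: tnth alpha i.
Proof.
(* Induction on the number [k] of reflections applied so far, those in the last [k] simple roots. *)
move=> Et; suff H k : (k <= l)%N -> foldr (@reflection R l) v (drop (l - k) alpha)
    = v - \sum_(i < l | (l - k <= i)%N) t i *: tnth alpha i.
  by have := H l (leqnn l); rewrite subnn drop0.
elim: k => [_|k IH lkl].
  rewrite subn0 drop_oversize ?size_tuple // big1 ?subr0 // => i.
  by rewrite leqNgt ltn_ord.
have lk : (l - k.+1 < l)%N by lia.
rewrite (drop_nth 0) ?size_tuple // (_ : (l - k.+1).+1 = (l - k)%N) /=; last by lia.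
pose i0 := Ordinal lk.
rewrite IH; last by lia.
rewrite -[alpha`_(l - k.+1)](tnth_nth 0 alpha i0) /reflection pairingBl pairing_suml.
have -> : \sum_(i < l | (l - k <= i)%N) t i * pairing (tnth alpha i) (tnth alpha i0)
    = \sum_(j < l | (i0 < j)%N) t j * pairing (tnth alpha j) (tnth alpha i0).
  by apply: eq_bigl => j /=; apply/idP/idP; lia.
rewrite -(Et i0) addrK [in RHS](bigD1 i0) //= opprD addrA addrAC; congr (_ - _ - _).
apply: eq_bigl => j; rewrite -val_eqE /=; apply/idP/idP; lia.
Qed.

(** The entries of [X L + U], where the Cartan matrix is [L + U] and its diagonal 2 is split evenly
    between the two triangular parts. *)
Definition coxeter_entry (i j : 'I_l) : {poly R} :=
  if i == j then 'X + 1
  else if (j < i)%N then 'X * (pairing (tnth alpha i) (tnth alpha j))%:P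
  else (pairing (tnth alpha i) (tnth alpha j))%:P.

(** By [coxeter_eltE] the Coxeter element has matrix [1 - (L + U) L^-1 = - U L^-1] in the simple
    roots. Multiplying [X + U L^-1] by [L], of determinant 1, gives [X L + U]. *)
Lemma char_poly_coxeter : basis_of fullv alpha ->
    (forall i, tnth alpha i != 0) ->
  char_poly (lin1_mx (coxeter_elt alpha))
    = \det (\matrix_(i, j) coxeter_entry i j).
Proof.
move=> alpha_basis alpha0; set K := lin1_mx _.
pose a i j := pairing (tnth alpha i) (tnth alpha j).
pose L : 'M[R]_l := \matrix_(i, j) (if i == j then 1 else if (j < i)%N then a i j else 0).
pose U : 'M[R]_l := \matrix_(i, j) (if i == j then 1 else if (j < i)%N then 0 else a i j).
pose B : 'M[R]_l := \matrix_i tnth alpha i.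
have detL : \det L = 1.
  rewrite det_trig; first by rewrite big1 // => i _; rewrite mxE eqxx.
  apply/is_trig_mxP=> i j ij; rewrite mxE -val_eqE /= ltn_eqF //.
  by rewrite ltnNge ltnW.
have uL : L \in unitmx by rewrite unitmxE detL unitr1.
have LU : (L + U) = \matrix_(i, j) a i j.
  apply/matrixP=> i j; rewrite !mxE; case: eqP => [->|_]; first by rewrite /a pairingvv.
  by case: ifP; rewrite ?addr0 ?add0r.
have uB : B \in unitmx.
  rewrite -row_free_unit -kermx_eq0; apply/eqP/row_matrixP => k; rewrite row0.
  set u := row k _; have uB0 : u *m B = 0 by rewrite -row_mul mulmx_ker row0.
  apply/rowP=> i; rewrite [RHS]mxE.
  have alpha_free := elimT freeP (basis_free alpha_basis).
  apply: (alpha_free (fun j => u 0 j)); rewrite -[RHS]uB0 mulmx_sum_row.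
  by apply: eq_bigr => j _; rewrite rowK (tnth_nth 0).
pose N := - (U *m invmx L).
have BK : B *m K = N *m B.
  apply/row_matrixP=> k; rewrite !row_mul mul_coxeter_mx rowK.
  pose t := row k ((L + U) *m invmx L).
  rewrite (@coxeter_eltE (fun i => t 0 i)) => [|i].
    have -> : N = 1%:M - (L + U) *m invmx L.
      by rewrite mulmxDl mulmxV // opprD addrA subrr sub0r.
    rewrite linearB /= mulmxBl row1 -rowE rowK -/t; congr (_ - _).
    by rewrite mulmx_sum_row; apply: eq_bigr => j _; rewrite rowK.
  have -> : pairing (tnth alpha k) (tnth alpha i) = (t *m L) 0 i.
    by rewrite -row_mul mulmxKV // mxE LU mxE.
  rewrite [RHS]mxE [in RHS](bigD1 i) //= [L i i]mxE eqxx mulr1; congr (_ + _).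
  rewrite big_mkcond [RHS]big_mkcond /=; apply: eq_bigr => j _.
  rewrite [L j i]mxE; case: eqP => [->|_]; first by rewrite ltnn.
  by case: ifP; rewrite // mulr0.
have detB : map_mx polyC B \in unitmx by rewrite map_unitmx.
have -> : char_poly K = char_poly N.
  have E : map_mx polyC B *m char_poly_mx K = char_poly_mx N *m map_mx polyC B.
    rewrite mulmxBr mulmxBl -!map_mxM BK; congr (_ - _).
    by rewrite scalar_mxC.
  have := congr1 determinant E; rewrite !det_mulmx mulrC => /(mulIr _); apply.
  by rewrite -unitmxE.
transitivity (\det (char_poly_mx N *m map_mx polyC L)).
  by rewrite det_mulmx det_map_mx detL mulr1.
congr (\det _); rewrite mulmxBl -map_mxM mulNmx -mulmxA mulVmx // mulmx1.
rewrite map_mxN opprK mul_scalar_mx; apply/matrixP=> i j; rewrite !mxE.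
rewrite /coxeter_entry -/(a i j).
case: eqP => _; first by rewrite mulr1.
by case: ifP => _; rewrite ?addr0 // mulr0 add0r.
Qed.

End CoxeterPolynomial.

Lemma diagram_type_morph (A B : comNzRingType) (f : {rmorphism A -> B}) X q n cm :
  diagram_type X q n cm -> diagram_type (f X) (f q) n cm.
Proof.
case=> n1 -> cmE; [apply: TypeA|apply: TypeBC|apply: TypeD|apply: TypeE6|
  apply: TypeE7|apply: TypeE8|apply: TypeF4] => //.
all: rewrite ?rmorph_sum; try (apply: eq_bigr => i _).
all: by rewrite ?(rmorphM, rmorphD, rmorphB, rmorphN, rmorphXn, rmorph1).
Qed.

(** * The marked diagram of a root system *)

Section RootSystem.
Variables (R : realType) (l : nat) (Phi Phip : {fset 'rV[R]_l}).
Variables (alpha : l.-tuple 'rV[R]_l) (theta : 'rV[R]_l).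
Hypotheses (l_ge2 : (2 <= l)%N) (Phi_root : root_system Phi)
  (Phi_cryst : crystallographic Phi) (Phi_irr : irreducible_roots Phi)
  (Phip_pos : positive_system Phi Phip) (alpha_simple : simple_system Phip alpha)
  (theta_highest : highest_root Phip alpha theta).

Local Notation al i := (tnth alpha i).
Local Notation co i v := (coord alpha i v).

Lemma posW b : b \in Phip -> b \in Phi.
Proof. exact: pos_sub Phip_pos b. Qed.

Lemma simple_in i : al i \in Phip.
Proof. exact: (simple_pos alpha_simple) (mem_tnth i alpha). Qed.

Lemma root_neq b : b \in Phi -> b != 0.
Proof. by apply: contraTneq => ->; exact: root_neq0 Phi_root. Qed.

Lemma simple_neq i : al i != 0.
Proof. exact/root_neq/posW/simple_in. Qed.

Lemma theta_in : theta \in Phip.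
Proof. by case: theta_highest. Qed.

Lemma theta_neq : theta != 0.
Proof. exact/root_neq/posW/theta_in. Qed.

Lemma reflection_in a b : a \in Phi -> b \in Phi -> reflection b a \in Phi.
Proof. by move=> aP bP; apply: root_reflection. Qed.

Lemma root_opp b : b \in Phi -> - b \in Phi.
Proof.
move=> bP; have := reflection_in bP bP.
by rewrite /reflection pairingvv ?root_neq // scaler_nat mulr2n opprD addrA subrr sub0r.
Qed.

Lemma coord_sum v : v = \sum_i co i v *: al i.
Proof.
rewrite {1}(coord_basis (simple_basis alpha_simple) (memvf v)).
by apply: eq_bigr => i _; rewrite (tnth_nth 0).
Qed.

Lemma coord_simple i j : co i (al j) = (i == j)%:R.
Proof.
rewrite (tnth_nth 0) coord_free ?(basis_free (simple_basis alpha_simple)) //.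
by rewrite eq_sym.
Qed.

Lemma coord_inj u v : (forall i, co i u = co i v) -> u = v.
Proof.
by move=> E; rewrite [u]coord_sum [v]coord_sum; apply: eq_bigr => i _; rewrite E.
Qed.

Lemma coord_pos_nat b i : b \in Phip -> co i b \is a Num.nat.
Proof. by move=> bP; apply: (simple_coord alpha_simple). Qed.

Lemma coord_pos_ge0 b i : b \in Phip -> 0 <= co i b.
Proof. by move=> bP; rewrite natr_ge0 // coord_pos_nat. Qed.

Lemma coord_gt0_pos b i : b \in Phi -> 0 < co i b -> b \in Phip.
Proof.
move=> bP ci; rewrite (pos_half Phip_pos bP); apply/negP => nb.
by have := coord_pos_ge0 i nb; rewrite linearN /=; lra.
Qed.

Lemma coord_reflection i b j :
  co j (reflection (al i) b) = co j b - pairing b (al i) * (j == i)%:R.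
Proof. by rewrite /reflection linearB linearZ /= coord_simple. Qed.

(** Otherwise [b] is a multiple of [al i], hence equal to it in a reduced system. *)
Lemma pos_coord_neq b i : b \in Phip -> b != al i ->
  exists2 j, j != i & 0 < co j b.
Proof.
move=> bP bi; have [/existsP [j /andP [ji cj]]|none] := boolP [exists j, (j != i) && (0 < co j b)].
  by exists j.
exfalso.
have co0 j : j != i -> co j b = 0.
  move=> ji; apply/eqP; rewrite eq_le coord_pos_ge0 // andbT leNgt.
  by move: none; rewrite negb_exists => /forallP /(_ j); rewrite ji.
have Eb : b = co i b *: al i.
  apply: coord_inj => j; rewrite linearZ /= coord_simple.
  by have [->|ji] := eqVneq; rewrite ?mulr1 // mulr0 co0.
have := posW bP; rewrite {1}Eb => /(root_reduced Phi_root (posW (simple_in i))).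
move=> [] E; move: Eb; rewrite E ?scale1r => Eb; first by rewrite Eb eqxx in bi.
by have := coord_pos_ge0 i bP; rewrite E; lra.
Qed.

(** Only the [i]-th coordinate changes, so a positive one elsewhere survives. *)
Lemma simple_reflection_pos b i : b \in Phip -> b != al i ->
  reflection (al i) b \in Phip.
Proof.
move=> bP bi; have [j ji cj] := pos_coord_neq bP bi.
apply: (@coord_gt0_pos _ j); first by rewrite reflection_in ?posW ?simple_in.
by rewrite coord_reflection (negbTE ji) mulr0 subr0.
Qed.

Lemma pairing_int a b : a \in Phi -> b \in Phi -> pairing a b \is a Num.int.
Proof. exact: Phi_cryst. Qed.

Lemma simple_inj i j : (al i == al j) = (i == j).
Proof.
apply/eqP/eqP => [E|-> //]; have := coord_simple i j; rewrite -E coord_simple eqxx.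
by case: eqP => // _ /eqP; rewrite oner_eq0.
Qed.

(** It is the [i]-th coordinate of the positive root [reflection (al i) (al j)]. *)
Lemma pairing_simple_nat i j : i != j -> - pairing (al j) (al i) \is a Num.nat.
Proof.
move=> ij; have ji : al j != al i by rewrite simple_inj eq_sym.
have := coord_pos_nat i (simple_reflection_pos (simple_in j) ji).
by rewrite coord_reflection coord_simple eqxx (negbTE ij) mulr1 sub0r.
Qed.

Lemma ht_pos_nat b : b \in Phip -> ht alpha b \is a Num.nat.
Proof. by move=> bP; apply: rpred_sum => i _; exact: coord_pos_nat. Qed.

Lemma ht_reflection b i :
  ht alpha (reflection (al i) b) = ht alpha b - pairing b (al i).
Proof.
rewrite /ht; under eq_bigr => j _ do rewrite coord_reflection.
rewrite sumrB; congr (_ - _); rewrite (bigD1 i) //= eqxx mulr1 big1 ?addr0 //.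
by move=> j /negbTE ->; rewrite mulr0.
Qed.

Lemma int_gt0_ge1 (x : R) : x \is a Num.int -> 0 < x -> 1 <= x.
Proof. by move=> /intrP [n ->]; rewrite ltr0z ler1z. Qed.

(** Induction on the height. As [inner b b > 0], a positive root pairs positively with some simple
    root; unless [b] is simple, reflecting in it keeps [b] positive and lowers its height by at
    least 1. *)
Lemma pos_root_ind (P : 'rV[R]_l -> Prop) :
    (forall i, P (al i)) ->
    (forall b i, b \in Phip -> 0 < pairing b (al i) ->
       reflection (al i) b \in Phip -> P (reflection (al i) b) -> P b) ->
  forall b, b \in Phip -> P b.
Proof.
move=> Pal Pref b bP; have [n] : exists n : nat, ht alpha b < n%:R.
  by exists (Num.truncn (ht alpha b)).+1; rewrite truncnS_gt.
elim: n b bP => [|n IH] b bP hb.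
  by have := ht_pos_nat bP => /natr_ge0; rewrite leNgt hb.
have [/existsP [i /eqP ->//]|nsimple] := boolP [exists i, b == al i].
have [i pi] : exists i, 0 < inner b (al i).
  have : inner b b != 0 by rewrite inner_eq0 root_neq ?posW.
  apply: contra_neqP => none; apply/eqP; rewrite eq_le inner_ge0 andbT.
  rewrite {1}[b]coord_sum inner_suml; apply: sumr_le0 => i _.
  rewrite innerZl innerC mulr_ge0_le0 ?coord_pos_ge0 // leNgt.
  by apply/negP => bi; case: none; exists i.
have pb : 0 < pairing b (al i) by rewrite pairing_gt0 ?simple_neq.
have rP : reflection (al i) b \in Phip.
  apply: simple_reflection_pos bP _.
  by move: nsimple; rewrite negb_exists => /forallP.
apply: (Pref b i) => //; apply: IH => //; rewrite ht_reflection.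
have := int_gt0_ge1 (pairing_int (posW bP) (posW (simple_in i))) pb.
by move: hb; rewrite -[n.+1%:R]natr1; lra.
Qed.

(** When [s] is closed under adjacency, the simple roots inside and outside it are orthogonal, and
    by [pos_root_ind] every root is supported on one side. Irreducibility empties one side, and
    [al i] lies inside. *)
Lemma simple_connected (s : seq 'I_l) i : i \in s ->
    (forall j k, j \in s -> inner (al k) (al j) != 0 -> k \in s) ->
  forall k, k \in s.
Proof.
move=> is_ scl.
pose inS (b : 'rV[R]_l) := [forall j, (j \notin s) ==> (co j b == 0)].
pose outS (b : 'rV[R]_l) := [forall j, (j \in s) ==> (co j b == 0)].
have inP b : reflect (forall j, j \notin s -> co j b = 0) (inS b).
  apply: (iffP forallP) => [H j js|H j]; last by apply/implyP=> /H ->.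
  by apply/eqP/(implyP (H j)).
have outP b : reflect (forall j, j \in s -> co j b = 0) (outS b).
  apply: (iffP forallP) => [H j js|H j]; last by apply/implyP=> /H ->.
  by apply/eqP/(implyP (H j)).
have orth a b : inS a -> outS b -> inner a b = 0.
  move=> /inP ain /outP bout.
  rewrite [a]coord_sum inner_suml big1 // => j _; rewrite innerZl.
  have [js|/ain ->] := boolP (j \in s); last by rewrite mul0r.
  rewrite [b]coord_sum innerC inner_suml big1 ?mulr0 // => k _; rewrite innerZl.
  have [/bout ->|ks] := boolP (k \in s); first by rewrite mul0r.
  apply/eqP; rewrite mulf_eq0; apply/orP; right.
  by apply: contraR ks => /(scl j k js).
have al_in j : j \in s -> inS (al j).
  by move=> js; apply/inP=> k; rewrite coord_simple; case: eqP => // ->; rewrite js.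
have al_out j : j \notin s -> outS (al j).
  move=> js; apply/outP=> k; rewrite coord_simple; case: eqP => // -> ks.
  by rewrite ks in js.
have in_or_out b : b \in Phip -> inS b || outS b.
  move: b; apply: pos_root_ind => [j|b j bP pb rP].
    by have [/al_in ->//|/al_out ->] := boolP (j \in s); rewrite orbT.
  have pr : inner (reflection (al j) b) (al j) != 0.
    have := pairing_inner (reflection (al j) b) (simple_neq j).
    rewrite pairing_reflection ?simple_neq // => E; apply/eqP => E0.
    have := inner_gt0 (simple_neq j).
    by rewrite E0 mulr0 in E; nra.
  case/orP => [rin|rout].
    have js : j \in s.
      by apply: contraR pr => js; rewrite orth // al_out.
    apply/orP; left; apply/inP => k ks; move/inP: rin => /(_ k ks).
    rewrite coord_reflection; case: eqP => [E|_]; first by rewrite E js in ks.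
    by rewrite mulr0 subr0.
  have js : j \notin s.
    by apply: contra pr => js; rewrite innerC orth // al_in.
  apply/orP; right; apply/outP => k ks; move/outP: rout => /(_ k ks).
  rewrite coord_reflection; case: eqP => [E|_]; first by rewrite E (negbTE js) in ks.
  by rewrite mulr0 subr0.
have orPhi b : b \in Phi -> inS b || outS b.
  move=> bP; have [/in_or_out//|nb] := boolP (b \in Phip).
  have /in_or_out : - b \in Phip.
    by move: nb; rewrite (pos_half Phip_pos bP) negbK.
  case/orP => [/inP H|/outP H]; apply/orP; [left; apply/inP|right; apply/outP];
    by move=> k /H /eqP; rewrite linearN oppr_eq0 => /eqP.
case: Phi_irr => _ /(_ [fset b in Phi | inS b]%fset [fset b in Phi | outS b]%fset).
case.
- apply/fsetP=> b; rewrite in_fsetU !inE; apply/idP/idP.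
    by move=> bP; rewrite bP /= orPhi.
  by rewrite -andb_orr => /andP [].
- apply/fdisjointP => b; rewrite !inE => /andP [bP /inP bin]; rewrite bP /=.
  apply: contra (root_neq bP) => /outP bout; apply/eqP/coord_inj => j.
  by rewrite linear0; have [/bout|/bin] := boolP (j \in s).
- by move=> a b; rewrite !inE => /andP [_ ain] /andP [_ bout]; exact: orth.
- move=> /fsetP /(_ (al i)); rewrite !inE al_in //.
  by rewrite posW ?simple_in.
move=> /fsetP B0 k; apply: contraT => ks; move: (B0 (al k)).
by rewrite !inE al_out // posW ?simple_in.
Qed.

Lemma coord_le_theta b i : b \in Phip -> co i b <= co i theta.
Proof.
move=> bP; case: theta_highest => _ /(_ b bP i) /natr_ge0.
by rewrite linearB /= subr_ge0.
Qed.

Lemma coord_theta_ge1 i : 1 <= co i theta.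
Proof. by have := coord_le_theta i (simple_in i); rewrite coord_simple eqxx. Qed.

(** Otherwise reflecting in [al i] would raise the [i]-th coordinate above its maximum. *)
Lemma theta_dominant i : 0 <= pairing theta (al i).
Proof.
rewrite leNgt; apply/negP => neg; have c1 := coord_theta_ge1 i.
have rP : reflection (al i) theta \in Phip.
  apply: (@coord_gt0_pos _ i).
    by rewrite reflection_in ?posW ?simple_in ?theta_in.
  by rewrite coord_reflection eqxx mulr1; lra.
have := coord_le_theta i rP.
by rewrite coord_reflection eqxx mulr1; lra.
Qed.

(** If [b] is dominant, then [theta - b], a nonnegative combination of simple roots, has nonnegative
    product with [theta + b]. Otherwise a simple reflection yields a higher root of the same
    length. *)
Lemma theta_long b : b \in Phip -> inner b b <= inner theta theta.
Proof.
move=> bP; have [n] : exists n : nat, ht alpha theta - ht alpha b < n%:R.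
  by exists (Num.truncn (ht alpha theta - ht alpha b)).+1; rewrite truncnS_gt.
have htle a : a \in Phip -> ht alpha a <= ht alpha theta.
  by move=> aP; apply: ler_sum => i _; exact: coord_le_theta.
elim: n b bP => [|n IH] b bP hb; first by have := htle b bP; lra.
have [/forallP dom|] := boolP [forall i, 0 <= pairing b (al i)].
  have nonneg v : (forall i, 0 <= pairing v (al i)) -> 0 <= inner (theta - b) v.
    move=> dv; rewrite [theta - b]coord_sum inner_suml; apply: sumr_ge0 => i _.
    rewrite innerZl innerC mulr_ge0 //.
      by rewrite linearB /= subr_ge0 coord_le_theta.
    by rewrite -pairing_ge0 ?simple_neq.
  have := nonneg _ dom; have := nonneg _ theta_dominant.
  rewrite !innerDl !innerNl (innerC b theta); lra.
rewrite negb_forall; case/existsP=> i; rewrite -ltNge => pb.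
have bi : b != al i.
  by apply: contraTneq pb => ->; rewrite pairingvv ?simple_neq // -leNgt.
rewrite -(inner_reflection b (simple_neq i)); apply: IH.
  exact: simple_reflection_pos.
have := int_gt0_ge1 (x := - pairing b (al i)).
rewrite rpredN pairing_int ?posW ?simple_in // oppr_gt0 => /(_ isT pb).
by move: hb; rewrite ht_reflection -[n.+1%:R]natr1; lra.
Qed.

(** With [p] the pairing, [p *: theta - al i] is a root. If [p >= 2], it exceeds [theta] in any
    coordinate [j != i], which exists in rank at least 2. *)
Lemma theta_pairing_le1 i : pairing (al i) theta <= 1.
Proof.
have pZ := pairing_int (posW (simple_in i)) (posW theta_in).
rewrite leNgt; apply/negP => p1.
have p2 : 2 <= pairing (al i) theta.
  move: p1 pZ => + /intrP [n E]; rewrite E -[1]/(1%:~R) -[2]/(2%:~R).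
  by rewrite ltr_int ler_int; lia.
have [j ji] : exists j, j != i.
  have [i0|i0] := eqVneq (val i) 0%N.
    by exists (Ordinal l_ge2); rewrite -val_eqE /= i0.
  by exists (Ordinal (ltnW l_ge2)); rewrite -val_eqE /= eq_sym.
have cE k : co k (- reflection theta (al i))
    = pairing (al i) theta * co k theta - (k == i)%:R.
  by rewrite linearN linearB linearZ /= coord_simple opprB.
have cj := coord_theta_ge1 j.
have nP : - reflection theta (al i) \in Phip.
  apply: (@coord_gt0_pos _ j); last by rewrite cE (negbTE ji) subr0; nra.
  by rewrite root_opp ?reflection_in ?posW ?simple_in ?theta_in.
by have := coord_le_theta j nP; rewrite cE (negbTE ji) subr0; nra.
Qed.

(* The coordinates of the coroot of [b] in the simple coroots. *)
Definition coroot_coord b i := co i b * inner (al i) (al i) / inner b b.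

(** Reflecting in [al j] keeps the length of [b] and changes only the [j]-th coordinate of its
    coroot, by the integer [pairing (al j) b]. *)
Lemma coroot_coord_int b i : b \in Phip -> coroot_coord b i \is a Num.int.
Proof.
move: b; apply: pos_root_ind => [j|b j bP pb rP rZ].
  rewrite /coroot_coord coord_simple; case: eqP => [->|_]; last by rewrite !mul0r.
  by rewrite mul1r divff ?inner_eq0 ?simple_neq.
have b0 := root_neq (posW bP).
have -> : coroot_coord b i = coroot_coord (reflection (al j) b) i
    + (i == j)%:R * pairing (al j) b.
  rewrite /coroot_coord inner_reflection ?simple_neq // coord_reflection.
  case: eqP => [->|_]; last by rewrite mulr0 subr0 mul0r addr0.
  have := pairing_inner b (simple_neq j).
  rewrite [pairing (al j) b]/pairing mul1r mulr1 (innerC (al j)) => <-.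
  by field; rewrite inner_eq0.
by rewrite rpredD // rpredM ?pairing_int ?posW ?simple_in // intr_nat.
Qed.

Definition diagram_b (i j : 'I_l) : nat :=
  if i == j then 0%N else Num.truncn (- pairing (al j) (al i)).
Definition diagram_c i := Num.truncn (co i theta).
Definition diagram_d i := Num.truncn (coroot_coord theta i).
Definition diagram_v i := Num.truncn (pairing (al i) theta).

Lemma diagram_bE i j :
  i != j -> pairing (al j) (al i) = - (diagram_b i j)%:R.
Proof.
move=> ij; rewrite /diagram_b (negbTE ij) truncnK ?opprK //.
exact: pairing_simple_nat.
Qed.

Lemma diagram_cE i : (diagram_c i)%:R = co i theta.
Proof. by rewrite truncnK // coord_pos_nat // theta_in. Qed.

Lemma int_ge0_nat (x : R) : x \is a Num.int -> 0 <= x -> x \is a Num.nat.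
Proof. by move=> xZ x0; rewrite natrEint xZ. Qed.

Lemma coroot_theta_gt0 i : 0 < coroot_coord theta i.
Proof.
by rewrite divr_gt0 ?mulr_gt0 ?inner_gt0 ?simple_neq ?theta_neq //
  (lt_le_trans _ (coord_theta_ge1 i)).
Qed.

Lemma diagram_dE i : (diagram_d i)%:R = coroot_coord theta i.
Proof.
rewrite truncnK // int_ge0_nat ?coroot_coord_int ?theta_in //.
exact/ltW/coroot_theta_gt0.
Qed.

Lemma diagram_vE i : (diagram_v i)%:R = pairing (al i) theta.
Proof.
rewrite truncnK // int_ge0_nat ?pairing_int ?posW ?simple_in ?theta_in //.
by rewrite pairing_ge0 ?theta_neq // innerC -pairing_ge0 ?simple_neq // theta_dominant.
Qed.

Lemma coroot_thetaE i :
  coroot_coord theta i * inner theta theta = co i theta * inner (al i) (al i).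
Proof. by rewrite divfK // inner_eq0 theta_neq. Qed.

Lemma diagram_sum (F : 'I_l -> R) i :
  \sum_j (diagram_b i j)%:R * F j = 2 * F i - \sum_j F j * pairing (al j) (al i).
Proof.
rewrite [in LHS](bigD1 i) //= [in RHS](bigD1 i) //= /diagram_b eqxx mul0r add0r.
rewrite pairingvv ?simple_neq // opprD addrA (mulrC (F i)) subrr sub0r -sumrN.
apply: eq_bigr => j ji; rewrite -/(diagram_b i j) diagram_bE 1?eq_sym // mulrN opprK.
exact: mulrC.
Qed.

(** The harmonic equation expands [theta] in simple roots inside [pairing theta (al i)], and
    multiplying by [d i] trades that pairing for [c i * v i]; the dual one expands the coroot. Times
    [inner theta theta], both sides of the symmetry are [-2 * inner (al i) (al j) * c i * c j]. The
    bound 3 is strict Cauchy-Schwarz. *)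
Lemma root_diagram : marked_diagram diagram_b diagram_c diagram_d diagram_v.
Proof.
have tt := inner_gt0 theta_neq.
have aa i := inner_gt0 (simple_neq i).
split.
- by rewrite card_ord.
- by move=> i; rewrite /diagram_b eqxx.
- by move=> i; rewrite -(ltr_nat R) diagram_dE coroot_theta_gt0.
- move=> i; rewrite -(ler_nat R) diagram_dE diagram_cE /coroot_coord -mulrA.
  rewrite ler_piMr ?(le_trans ler01 (coord_theta_ge1 i)) //.
  by rewrite ler_pdivrMr // mul1r theta_long ?simple_in.
- by move=> i; rewrite -(ler_nat R) diagram_vE theta_pairing_le1.
- apply/eqP; rewrite -(eqr_nat R) natr_sum; apply/eqP.
  under eq_bigr => i _ do rewrite natrM diagram_cE diagram_vE.
  by rewrite -pairing_suml -coord_sum pairingvv ?theta_neq.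
- move=> i; apply/eqP; rewrite -(eqr_nat R); apply/eqP.
  rewrite natrD !natrM natr_sum.
  under eq_bigr => j _ do rewrite natrM diagram_cE.
  rewrite diagram_sum -pairing_suml -coord_sum diagram_cE diagram_dE diagram_vE.
  have E1 := pairing_inner theta (simple_neq i).
  have E2 := pairing_inner (al i) theta_neq; have E3 := coroot_thetaE i.
  suff : pairing theta (al i) * coroot_coord theta i = co i theta * pairing (al i) theta.
    by move=> E; ring: E.
  apply: (mulIf (lt0r_neq0 tt)).
  transitivity (co i theta * (pairing theta (al i) * inner (al i) (al i))).
    by rewrite -mulrA E3; ring.
  by rewrite E1 -mulrA E2 (innerC theta).
- move=> i; apply/eqP; rewrite -(eqr_nat R); apply/eqP.
  rewrite natrD natrM natr_sum diagram_dE diagram_vE.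
  have -> : \sum_j (diagram_b j i * diagram_d j)%N%:R =
      2 * coroot_coord theta i - pairing (al i) theta.
    have -> : pairing (al i) theta = \sum_j coroot_coord theta j * pairing (al i) (al j).
      apply: (mulIf (lt0r_neq0 tt)); rewrite (pairing_inner _ theta_neq) mulr_suml.
      rewrite {1}[theta]coord_sum innerC inner_suml mulr_sumr; apply: eq_bigr => j _.
      rewrite innerZl mulrAC coroot_thetaE -mulrA (mulrC (inner _ _) (pairing _ _)).
      by rewrite pairing_inner ?simple_neq // (innerC (al j)); ring.
    rewrite (bigD1 i) //= [in RHS](bigD1 i) //= {1}/diagram_b eqxx mul0n add0r.
    rewrite pairingvv ?simple_neq // (mulrC 2) opprD addrA subrr sub0r -sumrN.
    apply: eq_bigr => j ji; rewrite natrM diagram_dE diagram_bE //.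
    by rewrite mulrN opprK mulrC.
  by ring.
- move=> i j; have [->//|ij] := eqVneq i j.
  apply/eqP; rewrite -(eqr_nat R); apply/eqP; rewrite !natrM.
  rewrite -[(diagram_b i j)%:R]opprK -[(diagram_b j i)%:R]opprK.
  rewrite -diagram_bE // -diagram_bE 1?eq_sym // !diagram_cE !diagram_dE.
  apply: (mulIf (lt0r_neq0 tt)).
  have E3 := coroot_thetaE i; have E4 := coroot_thetaE j.
  have E5 := pairing_inner (al i) (simple_neq j).
  have E6 := pairing_inner (al j) (simple_neq i); rewrite innerC in E6.
  transitivity (- (pairing (al j) (al i) * inner (al i) (al i)) * co i theta * co j theta).
    by ring: E3.
  by rewrite E6 -E5; ring: E4.
- move=> i j; have [->|ij] := eqVneq i j; first by rewrite /diagram_b eqxx.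
  rewrite -ltnS -(ltr_nat R) natrM.
  rewrite -[(diagram_b i j)%:R]opprK -[(diagram_b j i)%:R]opprK.
  rewrite -diagram_bE // -diagram_bE 1?eq_sym // mulrNN.
  have E5 := pairing_inner (al i) (simple_neq j).
  have E6 := pairing_inner (al j) (simple_neq i); rewrite innerC in E6.
  have ai := aa i; have aj := aa j.
  have : inner (al i) (al j) ^+ 2 < inner (al i) (al i) * inner (al j) (al j).
    apply: cauchy_schwarz_lt (simple_neq j) _ => c; apply/eqP => E.
    have := coord_simple i i; rewrite E linearZ /= coord_simple (negbTE ij).
    by rewrite mulr0 eqxx => /esym/eqP; rewrite oner_eq0.
  move=> lt; rewrite -(ltr_pM2r (mulr_gt0 ai aj)).
  have -> : pairing (al j) (al i) * pairing (al i) (al j)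
      * (inner (al i) (al i) * inner (al j) (al j)) = 4 * inner (al i) (al j) ^+ 2.
    transitivity ((pairing (al i) (al j) * inner (al j) (al j)) *
      (pairing (al j) (al i) * inner (al i) (al i))); first by ring.
    by rewrite E5 E6; ring.
  by rewrite ltr_pM2l.
move=> s i is_ scl; apply: (simple_connected is_) => j k js jk.
have [<-//|jk'] := eqVneq j k.
apply: (scl j) => //; apply: contraNneq jk => bjk.
have := diagram_bE jk'; rewrite bjk oppr0 => /eqP.
by rewrite mulf_eq0 invr_eq0 inner_eq0 (negbTE (simple_neq j)) orbF mulf_eq0 pnatr_eq0.
Qed.

(** * Coxeter matrix entries and pairings equal to 3 *)

Local Notation b := diagram_b.
Local Notation c := diagram_c.
Local Notation d := diagram_d.
Local Notation M := (coxeter_entry alpha).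

Lemma coxeter_entry_diag i : M i i = 'X + 1.
Proof. by rewrite /coxeter_entry eqxx. Qed.

Lemma coxeter_entry_edge i j :
  i != j -> M i j * M j i = (b i j * b j i)%:R * 'X.
Proof.
move=> ij; have ji : j != i by rewrite eq_sym.
rewrite /coxeter_entry (negbTE ij) (negbTE ji) (diagram_bE ij) (diagram_bE ji).
rewrite natrM !polyCN !polyC_natr.
by case: ltngtP ij => [_|_|/val_inj ->]; rewrite ?eqxx // => _; ring.
Qed.

Lemma coxeter_entry_nonedge i j : i != j -> b i j = 0%N -> M i j = 0.
Proof.
move=> ij /(b_eq0 root_diagram) bij; have ji : j != i by rewrite eq_sym.
rewrite /coxeter_entry (negbTE ij) (diagram_bE ji) bij.
by rewrite oppr0 polyC0 mulr0 if_same.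
Qed.

Lemma cmax_is_max cm : is_max c cm -> cmax alpha theta = cm%:R.
Proof.
move=> [[i ci] cle]; apply/le_anti/andP; split.
  apply/bigmax_leP; split=> [|j _]; first exact: ler0n.
  by rewrite -diagram_cE ler_nat.
by rewrite -ci diagram_cE; apply: le_bigmax.
Qed.

(** By Cauchy-Schwarz the reverse pairing would be 1, making [be] three times as long as [al i] in
    squared length. But [theta] is at least as long as [be], and its squared length is at most twice
    that of [al i]. *)
Lemma pairing_neq3 be i : (forall i, c i <= 2 * d i)%N -> be \in Phip ->
  pairing be (al i) <> 3.
Proof.
move=> c2d beP p3.
have aa := inner_gt0 (simple_neq i); have be0 := root_neq (posW beP).
have E1 := pairing_inner be (simple_neq i); have E2 := pairing_inner (al i) be0.
rewrite p3 in E1; rewrite innerC -E1 in E2.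
have CS := cauchy_schwarz be (al i); have bb := inner_gt0 be0.
have q0 : 0 < pairing (al i) be.
  by rewrite -(pmulr_lgt0 _ bb) E2 mulr_gt0.
have q1 := int_gt0_ge1 (pairing_int (posW (simple_in i)) (posW beP)) q0.
have q2 : pairing (al i) be < 2.
  have E3 : inner be (al i) = 3 / 2 * inner (al i) (al i).
    by apply: (mulfI (_ : 2 != 0 :> R)); rewrite // -E1; field.
  rewrite -(ltr_pM2r bb) E2; move: CS; rewrite E3 exprMn expr2 => CS.
  have : 9 / 4 * inner (al i) (al i) <= inner be be.
    by rewrite -(ler_pM2r aa); apply: le_trans CS; lra.
  by lra.
have q : pairing (al i) be = 1.
  move: q1 q2; have /intrP [n ->] := pairing_int (posW (simple_in i)) (posW beP).
  by rewrite ler1z -[2]/(2%:~R) ltr_int => n1 n2; have -> : n = 1 by lia.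
have long := theta_long beP; rewrite q mul1r in E2.
have := c2d i; rewrite -(ler_nat R) natrM diagram_cE diagram_dE.
have E3 := coroot_thetaE i; have d0 := coroot_theta_gt0 i.
move=> c2; have : coroot_coord theta i * (3 * inner (al i) (al i))
    <= 2 * coroot_coord theta i * inner (al i) (al i).
  apply: (@le_trans _ _ (co i theta * inner (al i) (al i))).
    by rewrite -E3 ler_pM2l // -E2.
  by rewrite ler_pM2r.
by have := mulr_gt0 d0 aa; lra.
Qed.

(** The root [be = al x + 3 al y] pairs to 3 with the short root [al y], so it suffices that the
    chain leaves [be] by subtracting [al y]. Subtracting [al x] would leave [3 al y], not a root. *)
Lemma G2_pairing_eq3 x y (U : {fset 'rV[R]_l}) (th : nat -> 'rV[R]_l) :
    perm_eq [:: x; y] (enum 'I_l) -> b x y = 1%N -> b y x = 3%N ->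
    (forall a, (a \in U) = (a \in Phip) && (1 < ht alpha a)) ->
    perm_eq [seq th i | i <- iota 1 #|` U|] U ->
    (forall i, (1 <= i < #|` U|)%N -> th i - th i.+1 \in alpha) ->
  exists2 t, (1 <= t < #|` U|)%N & pairing (th t) (th t - th t.+1) = 3.
Proof.
move=> pxy bxy byx UE thU thS.
have xy : x != y by move/perm_uniq: pxy; rewrite enum_uniq /= inE andbT => ->.
have yx : y != x by rewrite eq_sym.
have pyx := diagram_bE xy; have pxy' := diagram_bE yx.
rewrite bxy in pyx; rewrite byx in pxy'.
have ht1 i : ht alpha (al i) = 1.
  rewrite /ht (bigD1 i) //= coord_simple eqxx big1 ?addr0 // => j ji.
  by rewrite coord_simple (negbTE ji).
pose be := reflection (al y) (al x); pose ga := reflection (al x) (al y).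
have beP : be \in Phip by rewrite simple_reflection_pos ?simple_in ?simple_inj.
have gaP : ga \in Phip by rewrite simple_reflection_pos ?simple_in ?simple_inj.
have hbe : ht alpha be = 4 by rewrite ht_reflection ht1 pxy'; lra.
have hga : ht alpha ga = 2 by rewrite ht_reflection ht1 pyx; lra.
have inU a : a \in Phip -> 1 < ht alpha a ->
    exists2 t, (1 <= t <= #|` U|)%N & th t = a.
  move=> aP ha; have : a \in U by rewrite UE aP.
  rewrite -(perm_mem thU) => /mapP [t]; rewrite mem_iota => tm ->.
  by exists t => //; lia.
have [t tm Et] := inU be beP ltac:(lra).
have [u um Eu] := inU ga gaP ltac:(lra).
have hth k : (k < #|` U|)%N -> ht alpha (th k.+1) = ht alpha (th 1%N) - k%:R.
  elim: k => [|k IH] km; first by rewrite subr0.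
  have /tnthP [i Ei] := thS k.+1 km.
  have -> : th k.+2 = th k.+1 - al i by rewrite -Ei opprB addrC subrK.
  have -> : ht alpha (th k.+1 - al i) = ht alpha (th k.+1) - 1.
    by rewrite -(ht1 i) /ht -sumrB; apply: eq_bigr => j _; rewrite linearB.
  by rewrite IH ?(ltnW km) // -natr1; ring.
(* Heights drop by 1 along the chain, so [be], of height 4, cannot come last: [ga] has height 2. *)
have ltm : (t < #|` U|)%N.
  rewrite ltn_neqAle; case/andP: (tm) => t1 ->; rewrite andbT; apply/eqP => tU.
  have := hth t.-1; rewrite prednK // Et hbe => /(_ _) Ht.
  have := hth u.-1; rewrite prednK; last by case/andP: um.
  rewrite Eu hga => /(_ _) Hu.
  have {}Ht : 4 = ht alpha (th 1%N) - t.-1%:R by apply: Ht; lia.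
  have {}Hu : 2 = ht alpha (th 1%N) - u.-1%:R by apply: Hu; lia.
  have : (u.-1%:R <= t.-1%:R :> R) by rewrite ler_nat; lia.
  by lra.
exists t; first by case/andP: tm => ->.
have t1 : (1 <= t < #|` U|)%N by case/andP: tm => ->.
have /tnthP [i Ei] := thS t t1.
have : i \in [:: x; y] by rewrite (perm_mem pxy) mem_enum.
rewrite Ei !inE => /orP [/eqP|/eqP] iE; rewrite iE in Ei *; last first.
  by rewrite Et pairing_reflection ?simple_neq // pxy' opprK.
have : th t.+1 \in U.
  rewrite -(perm_mem thU) map_f // mem_iota; lia.
rewrite UE => /andP [/posW + _].
have -> : th t.+1 = 3 *: al y.
  have -> : th t.+1 = th t - al x by rewrite -Ei opprB addrC subrK.
  rewrite Et /be /reflection pxy' scaleNr opprK addrC addKr.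
  by [].
move=> /(root_reduced Phi_root (posW (simple_in y))) [] /eqP; lra.
Qed.

End RootSystem.

(** * The second exponent against the largest coefficient *)

Lemma coxeter_first_exponents (R : realType) n (alpha : n.+2.-tuple 'rV[R]_n.+2)
    (m : nat -> nat) N k :
    exponents alpha m -> (0 < k)%N ->
    exponent_roots (@unity_root R) N k
      (map_poly (real_complex R) (char_poly (lin1_mx (coxeter_elt alpha)))) ->
  m 1%N = 1%N /\ m 2%N = k.
Proof.
move=> [h [h0 cox_h cox_min] [mh msort Em]] k0; set K := lin1_mx _.
have KX i w : w *m (K ^+ i) = iter i (coxeter_elt alpha) w.
  elim: i w => [|i IH] w; first by rewrite expr0 mulmx1.
  by rewrite exprS mulmxA IH mul_coxeter_mx -iterSr.
apply: first_exponents h0 _ _ mh msort Em k0.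
  by apply/row_matrixP=> i; rewrite !rowE KX cox_h mulmx1.
by move=> i ih Ki; apply: (cox_min i ih) => w; rewrite -KX Ki mulmx1.
Qed.

Theorem theorem1p1 (R : realType) (l : nat) (Phi Phip : {fset 'rV[R]_l})
    (alpha : l.-tuple 'rV[R]_l) (theta_max : 'rV[R]_l) (m : nat -> nat)
    (theta : nat -> 'rV[R]_l)
    (l_ge2 : (2 <= l)%N)
    (Phi_root : root_system Phi)
    (Phi_cryst : crystallographic Phi)
    (Phi_irr : irreducible_roots Phi)
    (Phip_pos : positive_system Phi Phip)
    (alpha_simple : simple_system Phip alpha)
    (theta_max_highest : highest_root Phip alpha theta_max)
    (m_exp : exponents alpha m)
    (theta_enum :
      perm_eq [seq theta i | i <- iota 1 #|` upper_roots Phip alpha m|]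
              (upper_roots Phip alpha m))
    (theta_chain : forall i : nat,
      (1 <= i < #|` upper_roots Phip alpha m|)%N ->
      theta i - theta i.+1 \in alpha) :
  ((exists2 t : nat, (1 <= t < #|` upper_roots Phip alpha m|)%N &
      pairing (theta t) (theta t - theta t.+1) = 3) ->
    cmax alpha theta_max = (m 2%N)%:R - 2) /\
  (~ (exists2 t : nat, (1 <= t < #|` upper_roots Phip alpha m|)%N &
      pairing (theta t) (theta t - theta t.+1) = 3) ->
    cmax alpha theta_max = (m 2%N)%:R - 1).
Proof.
have upperE a : (a \in upper_roots Phip alpha m)
    = (a \in Phip) && ((m l.-1)%:R < ht alpha a) by rewrite !inE.
have md := root_diagram l_ge2 Phi_root Phi_cryst Phi_irr Phip_pos alpha_simple
  theta_max_highest.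
have alpha0 i := simple_neq Phi_root Phip_pos alpha_simple i.
have charpolyE : char_poly (lin1_mx (coxeter_elt alpha))
    = detseq (coxeter_entry alpha) (enum 'I_l).
  by rewrite detseq_enum char_poly_coxeter //; exact: simple_basis alpha_simple.
pose q := map_poly (real_complex R) (char_poly (lin1_mx (coxeter_elt alpha))).
have q_monic : q \is monic by rewrite map_monic char_poly_monic.
have q_size : size q = l.+1 by rewrite size_map_poly size_char_poly.
have exps N k : (0 < k)%N -> exponent_roots (@unity_root R) N k q ->
    m 1%N = 1%N /\ m 2%N = k.
  move=> k0; rewrite /q; clear - l_ge2 m_exp k0.
  case: l l_ge2 alpha m_exp => [|[|n]] // _ alpha m_exp.
  exact: coxeter_first_exponents.
have [[cm cm_max [c2d dt]]|[x [y [pxy cx cy [dx dy] [bxy byx]]]]] :=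
  marked_diagram_classification md (@coxeter_entry_diag _ _ alpha)
    (coxeter_entry_edge Phi_root Phip_pos alpha_simple)
    (coxeter_entry_nonedge l_ge2 Phi_root Phi_cryst Phi_irr Phip_pos alpha_simple
      theta_max_highest).
  have [N qN] : exists N, exponent_roots (@unity_root R) N cm.+1 q.
    apply: (diagram_type_roots _ q_monic q_size) => [N|]; first exact: unity_root_prim.
    rewrite -charpolyE card_ord in dt.
    by have := diagram_type_morph (map_poly (real_complex R)) dt; rewrite /= map_polyX.
  have [_ m2] := exps N cm.+1 isT qN.
  rewrite (cmax_is_max alpha_simple theta_max_highest cm_max) m2.
  (* Here [m 2 = cm + 1]; a pairing equal to 3 would be one of a positive root with a simple root,
     against [pairing_neq3]. *)
  split=> [[t tU pt]|_]; last by rewrite -[cm.+1%:R]natr1 addrK.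
  have /tnthP [i Ei] := theta_chain t tU.
  have : theta t \in upper_roots Phip alpha m.
    by rewrite -(perm_mem theta_enum) map_f // mem_iota; lia.
  rewrite upperE => /andP [tP _]; rewrite Ei in pt.
  by case: (pairing_neq3 l_ge2 Phi_root Phi_cryst Phip_pos alpha_simple
    theta_max_highest c2d tP pt).
have l2 : l = 2%N by rewrite -[l]card_ord cardE -(perm_size pxy).
(* In type G2 the determinant is [(X + 1)^2 - 3 X], the sixth cyclotomic polynomial. *)
have q6 : exponent_roots (@unity_root R) 6 5 q.
  apply: G2_roots q_monic _ _ => [N||]; first exact: unity_root_prim.
    by rewrite q_size l2.
  have xy : x != y by move/perm_uniq: pxy; rewrite enum_uniq /= inE andbT => ->.
  rewrite /q charpolyE -(detseq_perm _ pxy) detseq_leaf // detseq_isolated //.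
  rewrite detseq_nil !coxeter_entry_diag (coxeter_entry_edge Phi_root
    Phip_pos alpha_simple xy) bxy byx.
  rewrite !mulr1 mul1n rmorphB !rmorphM rmorphD /= rmorph1 rmorph_nat map_polyX.
  ring.
have [m1 m2] := exps 6%N 5%N isT q6.
have cm3 : is_max (diagram_c alpha theta_max) 3.
  split; first by exists y.
  move=> i; have : i \in [:: x; y] by rewrite (perm_mem pxy) mem_enum.
  by rewrite !inE => /orP [/eqP -> | /eqP ->]; rewrite ?cx ?cy.
rewrite (cmax_is_max alpha_simple theta_max_highest cm3) m2.
(* [3 = 5 - 2] settles the first claim; the second is vacuous once a [t] is exhibited. *)
split=> [_|[]]; first by lra.
apply: (G2_pairing_eq3 l_ge2 Phi_root Phip_pos alpha_simple pxy bxy byx) => // a.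
(* In rank 2 the bound is [m 1 = 1], so the upper roots are those of height above 1. *)
by rewrite upperE (_ : l.-1 = 1%N) ?m1 // l2.
Qed.
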